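(* Let $G$ be an abelian group with a free nice quasi-essential subgroup $F$. Then $G$ is generalized Bassian if, and only if, it is a B+E-group.
   Context: All groups are abelian. A free subgroup means a subgroup that is a free abelian group. A free subgroup $F$ of $G$ is quasi-essential in $G$ if $G/F$ is torsion. For a prime $p$, the localization of $G$ is $G_p=G\otimes\mathbb Z_{(p)}$, and similarly $F_p=F\otimes \mathbb Z_{(p)}\subseteq G_p$. The $p$-height $|x|_p$ of $x$ in a group or $\mathbb Z_{(p)}$-module $M$ is the ordinal $\alpha$ with $x\in p^\alpha M\setminus p^{\alpha+1}M$, or $\infty$ if $x\in p^\alpha M$ for all ordinals $\alpha$ (where $p^{\alpha+1}M=p(p^\alpha M)$ and intersections are taken at limits). A subgroup $F$ of $G$ is nice if, for every prime $p$, $F_p$ is nice in $G_p$, i.e., every coset of $F_p$ in $G_p$ contains an element of maximal $p$-height (computed in $G_p$) among elements of the coset. A group $G$ is Bassian (respectively, generalized Bassian) if, for every subgroup $N$ of $G$, the existence of an injective homomorphism $G\to G/N$ implies that $N=\{0\}$ (respectively, that $N$ is a direct summand of $G$). A torsion group $E$ is elementary if, for every prime $p$, its $p$-primary component $E_p$ satisfies $pE_p=0$. A group $G$ is a B+E-group if it decomposes as $G=A\oplus E$, where $A$ is Bassian and $E$ is elementary. *)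

(* Defs.v *)
From HB Require Import structures.
From mathcomp Require Import all_boot all_order all_algebra.
From mathcomp Require Import boolp classical_sets.
From mathcomp.multinomials Require Import freeg.

Set Implicit Arguments.
Unset Strict Implicit.
Unset Printing Implicit Defensive.

Import Order.TTheory GRing.Theory Num.Theory.
Local Open Scope ring_scope.

(* Subgroups of G are terms of type [zmodClosed G].  These are boolean
   predicates, which is no restriction in the presence of boolp. *)

Record subgroup_type (G : zmodType) (A : zmodClosed G) : Type := SubgroupElt {
  subgroup_val : G;
  _ : subgroup_val \in A
}.

HB.instance Definition _ (G : zmodType) (A : zmodClosed G) :=
  [isSub for @subgroup_val G A].
HB.instance Definition _ (G : zmodType) (A : zmodClosed G) :=
  [Choice of subgroup_type A by <:].
HB.instance Definition _ (G : zmodType) (A : zmodClosed G) :=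
  [SubChoice_isSubZmodule of subgroup_type A by <:].

Definition generated_subgroup (G : zmodType) (S : G -> Prop) : {pred G} :=
  fun x => `[< forall H : zmodClosed G, (forall y, S y -> y \in H) -> x \in H >].

Lemma generated_subgroup_zmod_closed (G : zmodType) (S : G -> Prop) :
  zmod_closed (generated_subgroup S).
Proof.
split=> [|x y /asboolP Hx /asboolP Hy]; apply/asboolP => H HS.
  exact: rpred0.
by apply: rpredB; [apply: Hx | apply: Hy].
Qed.

HB.instance Definition _ (G : zmodType) (S : G -> Prop) :=
  GRing.isZmodClosed.Build G (generated_subgroup S)
    (generated_subgroup_zmod_closed S).

Definition torsion (G : zmodType) : Prop :=
  forall x : G, exists2 n : nat, (0 < n)%N & x *+ n = 0.

Definition internal_direct_sum (G : zmodType) (A B : zmodClosed G) : Prop :=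
  (forall x : G, exists a b, [/\ a \in A, b \in B & x = a + b]) /\
  (forall x : G, x \in A -> x \in B -> x = 0).

Definition direct_summand (G : zmodType) (A : zmodClosed G) : Prop :=
  exists B : zmodClosed G, internal_direct_sum A B.

Definition free_abelian (G : zmodType) : Prop :=
  exists (K : choiceType) (f : {additive {freeg K / int} -> G}), bijective f.

Definition free_subgroup (G : zmodType) (F : zmodClosed G) : Prop :=
  free_abelian (subgroup_type F).

Definition quasi_essential (G : zmodType) (F : zmodClosed G) : Prop :=
  torsion (Quotient.quot F).

(* Tensor product over the integers: the free abelian group on A * B modulo
   biadditivity. *)
Definition biadditivity (A B : zmodType) (u : {freeg (A * B)%type / int}) :
    Prop :=
  (exists (a a' : A) (b : B),
     u = << (a + a', b) >> - << (a, b) >> - << (a', b) >>) \/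
  (exists (a : A) (b b' : B),
     u = << (a, b + b') >> - << (a, b) >> - << (a, b') >>).

Definition tensor (A B : zmodType) : Type :=
  Quotient.quot (generated_subgroup (@biadditivity A B)).
HB.instance Definition _ (A B : zmodType) := GRing.Zmodule.on (tensor A B).

Definition pure_tensor (A B : zmodType) (a : A) (b : B) : tensor A B :=
  \pi_(Quotient.quot (generated_subgroup (@biadditivity A B)))%qT
    << (a, b) >>.

(* The underlying set of Z_(p).  For prime p, being coprime to p is the same as
   not being divisible by p. *)
Definition in_Zloc (p : nat) : {pred rat} :=
  fun r => coprime p `|denq r|.

Lemma in_ZlocP (p : nat) (r : rat) :
  reflect (exists (m : int) (n : nat),
             [/\ (0 < n)%N, coprime p n & r = m%:~R / n%:R])
          (r \in in_Zloc p).
Proof.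
apply: (iffP idP) => [cop | [m [n [n_gt0 cop ->]]]].
  exists (numq r), `|denq r|%N; rewrite absz_gt0 denq_neq0; split=> //.
  by rewrite -{1}[r]divq_num_den -[X in _ / X%:~R]absz_denq.
apply: coprime_dvdr cop.
set q : rat := _ / _.
have n_neq0 : n%:R != 0 :> rat by rewrite pnatr_eq0 -lt0n.
have : numq q * n%:Z = m * denq q.
  apply: (@intr_inj rat); rewrite !rmorphM /= numqE -mulrA [_ * n%:~R]mulrC.
  by rewrite mulrA /q divfK.
move/(congr1 absz); rewrite !abszM /= => E.
have : (`|denq q| %| `|numq q| * n)%N by rewrite E dvdn_mull.
by rewrite Gauss_dvdr // coprime_sym coprime_num_den.
Qed.

Lemma in_Zloc_zmod_closed (p : nat) : zmod_closed (in_Zloc p).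
Proof.
split=> [|_ _ /in_ZlocP[m [n [n0 cn ->]]] /in_ZlocP[m' [n' [n0' cn' ->]]]].
  by apply/in_ZlocP; exists 0, 1%N; rewrite coprimen1 mul0r.
apply/in_ZlocP; exists (m * n' - m' * n), (n * n')%N.
rewrite muln_gt0 n0 n0' coprimeMr cn cn'; split=> //.
have nz : n%:R != 0 :> rat by rewrite pnatr_eq0 -lt0n.
have nz' : n'%:R != 0 :> rat by rewrite pnatr_eq0 -lt0n.
by rewrite -mulNr addf_div // natrM rmorphB !rmorphM /= mulNr.
Qed.

HB.instance Definition _ (p : nat) :=
  GRing.isZmodClosed.Build rat (in_Zloc p) (in_Zloc_zmod_closed p).

Definition Zloc (p : nat) : Type := subgroup_type (in_Zloc p).
HB.instance Definition _ (p : nat) := GRing.Zmodule.on (Zloc p).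

Definition localization (G : zmodType) (p : nat) : Type := tensor G (Zloc p).
HB.instance Definition _ (G : zmodType) (p : nat) :=
  GRing.Zmodule.on (localization G p).

(* F_p as a subgroup of G_p, i.e. the image of F (x) Z_(p) in G (x) Z_(p). *)
Definition localized_subgroup (G : zmodType) (F : zmodClosed G) (p : nat) :
    zmodClosed (localization G p) :=
  generated_subgroup (fun u : localization G p =>
    exists (x : G) (r : Zloc p), x \in F /\ u = pure_tensor x r).

(* Ordinals, presented by successors and suprema of arbitrary families; zero is
   the supremum of the empty family.  Every ordinal of the relevant size has
   such a presentation, usually many: [Ord_le] compares the ordinals, so that
   two terms present the same ordinal when each is [Ord_le] the other. *)
Inductive Ord : Type :=
| OSucc (a : Ord)
| OSup (T : Type) (f : T -> Ord).

(* The inner fixpoint is the strict order [a' < b]. *)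
Fixpoint Ord_le (a : Ord) : Ord -> Prop :=
  match a with
  | OSucc a' => fix lt (b : Ord) : Prop :=
      match b with
      | OSucc b' => Ord_le a' b'
      | OSup T g => exists j : T, lt (g j)
      end
  | OSup T f => fun b => forall i : T, Ord_le (f i) b
  end.

(* The subgroups p^a M.  They decrease with a, so the intersection over any
   family with supremum a is p^a M, and not only over all smaller ordinals. *)
Fixpoint ppower (M : zmodType) (p : nat) (a : Ord) : M -> Prop :=
  match a with
  | OSucc b => fun x => exists2 y, ppower p b y & x = y *+ p
  | OSup T f => fun x => forall i : T, ppower p (f i) x
  end.

(* [None] is the height oo. *)
Definition pheight (M : zmodType) (p : nat) (x : M) : option Ord :=
  match pselect (exists a, ppower p a x /\ ~ ppower p (OSucc a) x) with
  | left e => Some (projT1 (cid e))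
  | right _ => None
  end.

Definition height_le (h k : option Ord) : Prop :=
  match h, k with
  | _, None => True
  | None, Some _ => False
  | Some a, Some b => Ord_le a b
  end.

Definition nice_in (p : nat) (M : zmodType) (N : zmodClosed M) : Prop :=
  forall x : M, exists2 y : M, y - x \in N &
    forall z : M, z - x \in N -> height_le (pheight p z) (pheight p y).

Definition nice (G : zmodType) (F : zmodClosed G) : Prop :=
  forall p : nat, prime p -> nice_in p (localized_subgroup F p).

Definition Bassian (G : zmodType) : Prop :=
  forall N : zmodClosed G,
    (exists f : {additive G -> Quotient.quot N}, injective f) ->
    forall x : G, x \in N -> x = 0.

Definition generalized_Bassian (G : zmodType) : Prop :=
  forall N : zmodClosed G,
    (exists f : {additive G -> Quotient.quot N}, injective f) -> direct_summand N.

Definition in_primary_component (G : zmodType) (p : nat) (x : G) : Prop :=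
  exists k : nat, x *+ (p ^ k)%N = 0.

Definition elementary (E : zmodType) : Prop :=
  torsion E /\
  forall p : nat, prime p ->
    forall x : E, in_primary_component p x -> x *+ p = 0.

Definition BE_group (G : zmodType) : Prop :=
  exists A E : zmodClosed G,
    [/\ internal_direct_sum A E,
        Bassian (subgroup_type A) & elementary (subgroup_type E)].

(* Main.v *)
Require Import Defs.
From mathcomp Require Import all_boot all_order all_algebra.
From HB Require Import structures.
From mathcomp Require Import boolp classical_sets.
From mathcomp.multinomials Require Import freeg.

Set Implicit Arguments.
Unset Strict Implicit.
Unset Printing Implicit Defensive.

Import Order.TTheory GRing.Theory Num.Theory.
Local Open Scope ring_scope.

(** Write [T_p] for the [p]-primary component of [G].  Both properties in the
    theorem turn out to be equivalent to a finiteness condition, called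
    [finite_invariants] below: [G] has no free subgroup of infinite rank, and
    [p T_p] is finite for every prime [p].

    A generalized Bassian group satisfies it.  Suppose that a subgroup [H] of
    [G] both embeds in a divisible group [D] and maps onto [D], with kernel
    [N].  Since [D] is injective, it splits off [G / N], the complement being
    isomorphic to [G / H], and the embedding of [H] in [D] extends to [G]; so
    [G] embeds in [D + G / H], that is, in [G / N].  Hence [N] is a summand of
    [G], and [D] is isomorphic to a subgroup of [H]: this is
    [generalized_Bassian_section].  If [H] is reduced, that is absurd.  Taking
    for [H] a free group of countable rank excludes infinite rank; taking for
    [H] a sum of cyclic groups of orders [p ^ n_i] shows that [p ^ k G] has
    finite [p]-socle for large [k]; taking for [H] a nonzero divisible primary
    group, with [D = H] and the multiplication by [p] as surjection, would make
    its [p]-socle a summand, so [G] has no such subgroup.  The socles of [p ^ k G] for smaller [k >= 1] are treated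
    by a different argument: an infinite socle just above a finite one
    produces a summand [(Z / p ^ (k + 1))^(omega)], whose first cyclic factor
    can be shifted away so as to embed [G] in a quotient of itself by a
    subgroup of order [p] of [p ^ k G], which is never a summand.

    Conversely let [G] satisfy the finiteness condition.  Its free
    quasi-essential subgroup [F] is finitely generated, so that
    [T_p] meets [p G + F] in a finite group [W_p].  The main tool is the
    splitting criterion [direct_summand_of_primewise]: a torsion subgroup [N]
    is a summand as soon as its [p]-socle avoids [p G] for all [p] and
    [p G + F] for almost all [p].  Indeed there are then complements [C_p] of
    the [p]-socles of [N] which contain [p G], and [F] for almost all [p];
    since each [x] has a multiple in [F], it lies in almost all [C_p], and
    therefore the intersection of the [C_p] is a complement of [N].

    - [G] is generalized Bassian: an injection of [G] into [G / N] forces [N]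
      to be torsion, because of the absence of infinite free subgroups; it
      maps [p T_p], and [W_p] for almost all [p], into their images in
      [G / N], and counting shows that [N] meets these finite groups trivially.
    - [G] is a B+E-group: a maximal torsion subgroup [E] whose [p]-socles
      avoid [p G + F] is elementary and splits off, and maximality makes the
      primary components of its complement finite; together with finite rank
      this makes the complement Bassian.

    Finally a B+E-group inherits the finiteness condition from its Bassian
    summand, which is in particular generalized Bassian. *)

(** * Subgroups, quotients and additive maps *)

Definition is_subgroup (G : zmodType) (P : G -> Prop) : Prop :=
  P 0 /\ forall x y, P x -> P y -> P (x - y).

Lemma subgroup_of_prop (G : zmodType) (P : G -> Prop) :
  is_subgroup P -> exists N : zmodClosed G, forall x, x \in N <-> P x.
Proof.
case=> P0 PB; pose S : {pred G} := fun x => `[< P x >].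
have S_closed : zmod_closed S.
  by split=> [|x y /asboolP Px /asboolP Py]; apply/asboolP; [|exact: PB].
pose N : zmodClosed G := HB.pack S (GRing.isZmodClosed.Build G S S_closed).
by exists N => x; split=> [/asboolP|Px]; [|apply/asboolP].
Qed.

Lemma additive_of_fun (U V : zmodType) (f : U -> V) :
  (forall x y, f (x - y) = f x - f y) ->
  exists g : {additive U -> V}, forall x, g x = f x.
Proof.
move=> fB.
pose g : {additive U -> V} := HB.pack f (GRing.isZmodMorphism.Build U V f fB).
by exists g.
Qed.

Definition quotient_map (G : zmodType) (N : zmodClosed G) :
  {additive G -> Quotient.quot N} := \pi_(Quotient.quot N)%qT.

Lemma quotient_map_eq (G : zmodType) (N : zmodClosed G) (x y : G) :
  quotient_map N x = quotient_map N y <-> x - y \in N.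
Proof. by rewrite Quotient.idealrBE; split=> [h|/eqP //]; apply/eqP. Qed.

Lemma quotient_map_eq0 (G : zmodType) (N : zmodClosed G) (x : G) :
  quotient_map N x = 0 <-> x \in N.
Proof. by rewrite -[x in x \in _]subr0 -quotient_map_eq raddf0. Qed.

Lemma quotient_map_surj (G : zmodType) (N : zmodClosed G)
  (q : Quotient.quot N) : exists x, quotient_map N x = q.
Proof. by exists (repr q); exact: reprK. Qed.

(** The map is defined through a set-theoretic section of [s], the choice being
    irrelevant because [v] kills the kernel of [s]. *)
Lemma factor_additive (P D V : zmodType) (s : {additive P -> D})
    (v : {additive P -> V}) :
  (forall d, exists a, s a = d) -> (forall a, s a = 0 -> v a = 0) ->
  exists g : {additive D -> V}, forall a, g (s a) = v a.
Proof.
move=> /choice[r rK] ker.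
have v_eq a b : s a = s b -> v a = v b.
  move=> sE; apply/eqP; rewrite -subr_eq0 -raddfB ker ?raddfB ?sE ?subrr //.
have [|g gE] := @additive_of_fun D V (v \o r).
  by move=> x y /=; rewrite -raddfB; apply: v_eq; rewrite raddfB !rK.
by exists g => a; rewrite gE /=; apply: v_eq; rewrite rK.
Qed.

(** Zorn's lemma for subgroups all of whose elements satisfy [phi]: a condition on
    single elements passes to unions of chains.  Both the complements and the
    elementary part of a B+E-group come from it. *)
Lemma subset_maximal_subgroup (G : zmodType) (phi : G -> Prop)
    (C0 : zmodClosed G) :
  (forall x, x \in C0 -> phi x) ->
  exists C : zmodClosed G,
    [/\ {subset C0 <= C}, forall x, x \in C -> phi x
      & forall C' : zmodClosed G, {subset C <= C'} ->
          (forall x, x \in C' -> phi x) -> {subset C' <= C}].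
Proof.
move=> phiC0.
pose good (A : set G) := [/\ is_subgroup A, forall x, x \in C0 -> A x
  & forall x, A x -> phi x].
(* The union of the empty chain is empty, so the empty set is admitted. *)
have [F sub tot|A [Agood Amax]] :=
  @Zorn_bigcup G (fun A => A = set0 \/ good A).
  have [[A FA Agood]|none] := pselect (exists2 A, F A & good A); last first.
    left; apply/seteqP; split=> x // -[A FA Ax].
    by case: (sub A FA) Ax => [-> //|gA]; case: none; exists A.
  right; split; last 1 first.
  - move=> x [B FB Bx]; case: (sub B FB) Bx => [-> //|[_ _ h]]; exact: h.
  - split=> [|x y [B FB Bx] [C FC Cy]].
      by exists A => //; case: Agood => -[].
    have big D : F D -> forall z, D z -> is_subgroup D.
      by move=> FD z; case: (sub D FD) => [-> //|[]].
    case: (tot B C FB FC) => BC.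
    + by exists C => //; case: (big _ FC _ Cy) => _; apply=> //; exact: BC.
    + by exists B => //; case: (big _ FB _ Bx) => _; apply=> //; exact: BC.
  - by move=> x xC; exists A => //; case: Agood => _ h _; exact: h.
have goodC0 : good (fun x => x \in C0).
  by split=> //; split=> [|x y]; [exact: rpred0|exact: rpredB].
have [A0|[subA C0A phiA]] := Agood.
  exfalso; apply: (Amax (fun x => x \in C0)); last by right.
  rewrite A0; split=> [x //|/(_ 0)]; apply; exact: rpred0.
have [C CE] := subgroup_of_prop subA.
exists C; split=> [x /C0A|x /CE/phiA|C' CC' phiC' x xC'] //; first by move/CE.
apply/CE; apply: contrapT => nAx.
apply: (Amax (fun x => x \in C')); last first.
  right; split=> //; first by split=> [|z y]; [exact: rpred0|exact: rpredB].
  by move=> z /C0A/CE/CC'.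
by split=> [z /CE/CC'|/(_ x xC')].
Qed.

Definition divisible (D : zmodType) : Prop :=
  forall (n : nat) (d : D), (0 < n)%N -> exists d', d = d' *+ n.

(** A subgroup [C] maximal among those that contain [C0] and avoid [H] is a
    complement as soon as any [x] can be moved by an element [h] of [H] so that
    the multiples of [x - h] lying in [H + C] lie in [C]: adjoining [x - h] to
    [C] then keeps it disjoint from [H]. *)
Lemma complement_exists (G : zmodType) (H C0 : zmodClosed G) :
  (forall x, x \in C0 -> x \in H -> x = 0) ->
  (forall C : zmodClosed G, {subset C0 <= C} ->
    (forall x, x \in C -> x \in H -> x = 0) ->
    forall x, exists2 h, h \in H & forall j : int,
      (exists2 h', h' \in H & (x - h) *~ j - h' \in C) ->
      (x - h) *~ j \in C) ->
  exists C : zmodClosed G, {subset C0 <= C} /\ internal_direct_sum H C.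
Proof.
move=> dis step.
have [x xC0|C [C0C disC maxC]] :=
  @subset_maximal_subgroup G (fun x => x \in H -> x = 0) C0.
  exact: dis.
exists C; split=> //; split=> [x|x xH xC]; last exact: disC.
have [h hH hj] := step C C0C disC x.
exists h, (x - h); split=> //; last by rewrite addrC subrK.
pose y := x - h.
have [|C' C'E] := @subgroup_of_prop G
    (fun z => exists2 c, c \in C & exists j : int, z = c + y *~ j).
  split; first by exists 0; [exact: rpred0|exists 0; rewrite mulr0z addr0].
  move=> z1 z2 [c cC [j ->]] [c' c'C [j' ->]].
  exists (c - c'); first exact: rpredB.
  by exists (j - j'); rewrite mulrzBr addrACA opprD.
apply: (maxC C') => [z zC|z /C'E[c cC [j ->]] zH|].
- by apply/C'E; exists z => //; exists 0; rewrite mulr0z addr0.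
- have yC : y *~ j \in C.
    by apply: hj; exists (c + y *~ j) => //; rewrite opprD addrCA subrr addr0 rpredN.
  by apply: disC => //; exact: rpredD.
- by apply/C'E; exists 0; [exact: rpred0|exists 1; rewrite mulr1z add0r].
Qed.

(** * Complements and injectivity of divisible groups *)

(** Let [n] be the order of [x] modulo [H + C], and write [n x = c + h].  If
    [h = n h'] with [h'] in [H], then [n (x - h')] is in [C], which is what
    [complement_exists] asks for; if [x] has infinite order modulo [H + C],
    nothing has to be corrected. *)
Lemma complement_of_solvable (G : zmodType) (H C0 : zmodClosed G) :
  (forall x, x \in C0 -> x \in H -> x = 0) ->
  (forall C : zmodClosed G, {subset C0 <= C} ->
    (forall x, x \in C -> x \in H -> x = 0) ->
    forall (x h : G) (n : nat), (0 < n)%N -> h \in H -> x *+ n - h \in C ->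
      (forall r, (exists2 h', h' \in H & x *+ r - h' \in C) -> (n %| r)%N) ->
      exists2 h', h' \in H & h = h' *+ n) ->
  exists C : zmodClosed G, {subset C0 <= C} /\ internal_direct_sum H C.
Proof.
move=> dis solv; apply: complement_exists => // C C0C disC x.
pose hits (y : G) (r : nat) := exists2 h', h' \in H & y *+ r - h' \in C.
have hits_abs y (j : int) :
    (exists2 h', h' \in H & y *~ j - h' \in C) -> hits y `|j|%N.
  case=> h' h'H; case: j => r; first by exists h'.
  rewrite NegzE mulrNz => hC; exists (- h'); first by rewrite rpredN.
  by rewrite -rpredN opprD opprK.
have [some|none] := pselect (exists n, (0 < n)%N && `[< hits x n >]); last first.
  exists 0; rewrite ?rpred0 // subr0 => j /hits_abs.
  case: (posnP `|j|%N) => [/eqP|j_gt0 hj].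
    by rewrite absz_eq0 => /eqP-> _; rewrite mulr0z rpred0.
  by case: none; exists `|j|%N; rewrite j_gt0; apply/asboolP.
case: (ex_minnP some) => n /andP[n_gt0 /asboolP[h hH hC]] n_min.
(* The set of hits is a group of integers, generated by its least positive element. *)
have n_dvd r : hits x r -> (n %| r)%N.
  case=> h' h'H h'C; rewrite /dvdn -leqn0 leqNgt; apply/negP => r_gt0.
  have /n_min : (0 < r %% n)%N && `[< hits x (r %% n)%N >].
    rewrite r_gt0; apply/asboolP; exists (h' - h *+ (r %/ n)).
      by rewrite rpredB ?rpredMn.
    have xr : x *+ r = x *+ n *+ (r %/ n) + x *+ (r %% n).
      by rewrite {1}(divn_eq r n) mulrnDr mulnC mulrnA.
    have -> : x *+ (r %% n) - (h' - h *+ (r %/ n)) =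
        x *+ r - h' - (x *+ n - h) *+ (r %/ n).
      rewrite xr mulrnBl !opprB [RHS](AC (3*2) ((2*(4*3))*(1*5))).
      by rewrite /= subrr addr0.
    by rewrite rpredB ?rpredMn.
  by rewrite leqNgt ltn_mod n_gt0.
have [h' h'H hE] := solv C C0C disC x h n n_gt0 hH hC n_dvd.
exists h' => // j /hits_abs[h'' h''H]; rewrite mulrnBl -addrA -opprD => jC.
have yC : (x - h') *+ n \in C by rewrite mulrnBl -hE.
have /n_dvd/dvdnP[q qE] : hits x `|j|%N.
  by exists (h' *+ `|j| + h'') => //; rewrite rpredD ?rpredMn.
have : (x - h') *+ `|j|%N \in C by rewrite qE mulnC mulrnA rpredMn.
by case: (j) => // r; rewrite NegzE mulrNz rpredN.
Qed.

Lemma divisible_complement (G : zmodType) (H C0 : zmodClosed G) :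
  (forall (n : nat) h, (0 < n)%N -> h \in H ->
    exists2 h', h' \in H & h = h' *+ n) ->
  (forall x, x \in C0 -> x \in H -> x = 0) ->
  exists C : zmodClosed G, {subset C0 <= C} /\ internal_direct_sum H C.
Proof.
move=> divH dis; apply: complement_of_solvable => // C _ _ x h n n_gt0 hH _ _.
exact: divH.
Qed.

(** [m H] vanishes, lying in both [C0] and [H]; the condition relating [n1] and
    [n2] then says that [H] is injective as a module over the integers modulo
    [m].  It holds for elementary groups with [m]
    prime, and for sums of cyclic groups of order [m]. *)
Lemma bounded_complement (G : zmodType) (m : nat) (H C0 : zmodClosed G) :
  (0 < m)%N -> (forall x, x *+ m \in C0) ->
  (forall (n1 n2 : nat) h, (n1 * n2 = m)%N -> h \in H -> h *+ n1 = 0 ->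
    exists2 h', h' \in H & h = h' *+ n2) ->
  (forall x, x \in C0 -> x \in H -> x = 0) ->
  exists C : zmodClosed G, {subset C0 <= C} /\ internal_direct_sum H C.
Proof.
move=> m_gt0 mG selfinj dis.
apply: complement_of_solvable => // C C0C disC x h n n_gt0 hH xhC n_dvd.
have /dvdnP[n1 mE] : (n %| m)%N.
  by apply: n_dvd; exists 0; rewrite ?rpred0 // subr0 C0C.
apply: (selfinj n1) => //; apply: disC; last by rewrite rpredMn.
have -> : h *+ n1 = x *+ m - (x *+ n - h) *+ n1.
  by rewrite mE mulnC mulrnA -mulrnBl opprB addrC subrK.
by apply: rpredB; [exact: C0C | rewrite rpredMn].
Qed.

Lemma additive_projection (G : zmodType) (N B : zmodClosed G) :
  internal_direct_sum N B ->
  exists r : {additive G -> G},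
    [/\ forall x, r x \in B, forall x, x - r x \in N
      & forall x, x \in N -> r x = 0].
Proof.
case=> NB dis.
have /choice[r rE] x : exists b, b \in B /\ x - b \in N.
  by have [n [b [nN bB ->]]] := NB x; exists b; rewrite addrK.
have r_uniq x b : b \in B -> x - b \in N -> r x = b.
  move=> bB xbN; have [rB rN] := rE x.
  apply/eqP; rewrite -subr_eq0; apply/eqP/dis; last exact: rpredB.
  have -> : r x - b = (x - b) - (x - r x) by rewrite opprB [RHS]addrC subrKA.
  exact: rpredB.
have [|g gE] := @additive_of_fun G G r.
  move=> x y; have [[rxB rxN] [ryB ryN]] := (rE x, rE y).
  apply: r_uniq; first exact: rpredB.
  have -> : x - y - (r x - r y) = (x - r x) - (y - r y).
    by rewrite !opprD addrACA.
  exact: rpredB.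
exists g; split=> x; rewrite gE; try by case: (rE x).
by move=> xN; apply: r_uniq; rewrite ?rpred0 // subr0.
Qed.

(** Divisible groups are injective.  The extension is the complement of [0 * D]
    in [G * D] that contains the graph of the partial map; [i] need not be
    injective. *)
Lemma divisible_extension (P G D : zmodType) (i : {additive P -> G})
    (f : {additive P -> D}) :
  divisible D -> (forall v, i v = 0 -> f v = 0) ->
  exists g : {additive G -> D}, forall v, g (i v) = f v.
Proof.
move=> divD ker.
have [|H HE] := @subgroup_of_prop (G * D)%type (fun z => z.1 = 0).
  by split=> // -[x d] [y d'] /= -> ->; rewrite subrr.
have [|C0 C0E] := @subgroup_of_prop (G * D)%type
    (fun z => exists v, z = (i v, f v)).
  split; first by exists 0; rewrite !raddf0.
  by move=> _ _ [v ->] [w ->]; exists (v - w); rewrite !raddfB.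
have [|_ /C0E[v ->] /HE/= iv0|C [C0C [HC dis]]] := @divisible_complement _ H C0.
- move=> n [x d] n_gt0 /HE/= ->; have [d' ->] := divD n d n_gt0.
  by exists (0, d'); [apply/HE|rewrite pairMnE /= mul0rn].
- by rewrite iv0 ker.
have /choice[g gC] x : exists d, (x, d) \in C.
  have [h [[y d] [/HE h0 cC /eqP]]] := HC (x, 0).
  by rewrite xpair_eqE h0 /= add0r => /andP[/eqP-> _]; exists d.
have g_uniq x d : (x, d) \in C -> g x = d.
  move=> xdC; apply/eqP; rewrite -subr_eq0; apply/eqP.
  have zH : (0, g x - d) \in H by apply/HE.
  have zC : (0, g x - d) \in C.
    by rewrite -(subrr x); exact: (rpredB (gC x) xdC).
  by have [] := dis _ zH zC.
have [|g' g'E] := @additive_of_fun G D g.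
  by move=> x y; apply: g_uniq; exact: (rpredB (gC x) (gC y)).
exists g' => v; rewrite g'E; apply: g_uniq.
by apply/C0C/C0E; exists v.
Qed.

(** * Divisible quotients of subgroups of generalized Bassian groups *)

(** The kernel [N] of [s], transported to [G], is such that [u P / N] is a copy
    of [D].  With [e] the copy of [D] in [G / N], [rho] a retraction onto it and
    [psi] an extension of [j] to [G], the map
    [x |-> e (psi x) + (x - e (rho x))] embeds [G] in [G / N].  Thus [N] is a
    summand of [G], which lifts [D] back to [G] inside [u P]. *)
Lemma generalized_Bassian_section (G P D : zmodType) (u : {additive P -> G})
    (s j : {additive P -> D}) :
  generalized_Bassian G -> divisible D ->
  (forall d, exists v, s v = d) -> (forall v, u v = 0 -> s v = 0) ->
  (forall v, j v = 0 <-> u v = 0) ->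
  exists b : {additive D -> G},
    forall v, exists2 w, s w = 0 & b (s v) = u (v - w).
Proof.
move=> GB divD s_surj ker_us ker_j.
have [|N NE] := @subgroup_of_prop G (fun x => exists2 w, s w = 0 & x = u w).
  split; first by exists 0; rewrite raddf0.
  by move=> _ _ [v sv ->] [w sw ->]; exists (v - w); rewrite raddfB ?sv ?sw ?subrr.
pose pi := quotient_map N.
have [a sa0|e eE] := @factor_additive _ _ _ s (pi \o u) s_surj.
  by apply/quotient_map_eq0/NE; exists a.
have [d ed0|rho rhoE] := @divisible_extension _ _ _ e idfun divD.
  have [v vd] := s_surj d; move: ed0; rewrite -vd eE /=.
  case/quotient_map_eq0/NE => w sw /eqP; rewrite -subr_eq0 -raddfB => /eqP.
  by move=> /ker_us; rewrite raddfB sw subr0.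
have [v /ker_j //|psi psiE] := @divisible_extension _ _ _ u j divD.
have [|phi phiE] := @additive_of_fun G (Quotient.quot N)
    (fun x => e (psi x) + (pi x - e (rho (pi x)))).
  move=> x y /=; rewrite !raddfB opprD [RHS]addrACA; congr (_ + _).
  by rewrite !opprD addrACA.
have phi_inj : injective phi.
  move=> x y /eqP; rewrite -subr_eq0 -raddfB => /eqP.
  move=> h; apply/eqP; rewrite -subr_eq0; apply/eqP.
  move: (x - y) h => z; rewrite phiE => h.
  (* Apply [rho]: the second summand of [phi] lies in the kernel of [rho]. *)
  have psi0 : psi z = 0.
    have := congr1 rho h.
    by rewrite raddfD raddfB !rhoE raddf0 /= subrr addr0.
  move: h; rewrite psi0 raddf0 add0r => /eqP; rewrite subr_eq0 => /eqP.
  have [v <-] := s_surj (rho (pi z)).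
  rewrite eE /= => /quotient_map_eq/NE[w sw /eqP]; rewrite subr_eq addrC -raddfD.
  by move/eqP=> zE; move: psi0; rewrite zE psiE => /ker_j.
have [B /additive_projection[r [rB rN r0]]] := GB N (ex_intro _ phi phi_inj).
have [a sa0|b bE] := @factor_additive _ _ _ s (r \o u) s_surj.
  by apply: r0; apply/NE; exists a.
exists b => v; have /NE[w sw wE] := rN (u v).
by exists w => //; rewrite bE raddfB -wE opprB addrC subrK.
Qed.

(** The polynomials with integer coefficients serve as the free abelian group of
    countable rank, with basis the monomials. *)
Lemma poly_lift (G : zmodType) (y : nat -> G) :
  exists u : {additive {poly int} -> G}, forall (a : {poly int}) n,
    (size a <= n)%N -> u a = \sum_(i < n) y i *~ a`_i.
Proof.
pose f (a : {poly int}) := \sum_(i < size a) y i *~ a`_i.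
have fE (a : {poly int}) n : (size a <= n)%N -> f a = \sum_(i < n) y i *~ a`_i.
  move=> an; rewrite -(big_mkord xpredT (fun i => y i *~ a`_i)).
  rewrite (@big_cat_nat _ _ _ (size a)) //= big_mkord.
  rewrite [X in _ + X]big_nat_cond [X in _ + X]big1 ?addr0 // => i.
  by case/andP=> /andP[ai _] _; rewrite nth_default // mulr0z.
have [|u uE] := @additive_of_fun _ _ f.
  move=> a b; pose n := maxn (size a) (size b).
  rewrite (fE a n) ?leq_maxl // (fE b n) ?leq_maxr // (fE (a - b) n).
    by rewrite -sumrB; apply: eq_bigr => i _; rewrite coefB mulrzBr.
  by rewrite (leq_trans (size_polyD _ _)) // size_polyN.
by exists u => a n an; rewrite uE (fE a n).
Qed.

Lemma poly_liftXn (G : zmodType) (y : nat -> G) (u : {additive {poly int} -> G}) :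
  (forall (a : {poly int}) n, (size a <= n)%N -> u a = \sum_(i < n) y i *~ a`_i) ->
  forall i, u 'X^i = y i.
Proof.
move=> uE i; rewrite (uE _ i.+1) ?size_polyXn // big_ord_recr /= coefXn eqxx.
by rewrite big1 ?add0r // => k _; rewrite coefXn ltn_eqF.
Qed.

(** The image of [u] is the sum of the cyclic groups of orders [d i], where order
    [0] means infinite cyclic.  It embeds in [D = (Q / L)[X]] by sending the
    [i]-th generator to [c i] at ['X^i], and maps onto [D] by sending it to
    [e i].  It contains no nonzero divisible subgroup, although
    [generalized_Bassian_section] lifts [D] into it. *)
Lemma generalized_Bassian_no_scattered_sum (G : zmodType) (L : zmodClosed rat)
    (e : nat -> {poly rat}) (d : nat -> nat) (c : nat -> rat)
    (u : {additive {poly int} -> G}) :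
  generalized_Bassian G -> (exists r, r \notin L) ->
  (forall q, exists i, e i = q) ->
  (forall i k, (e i)`_k *+ d i \in L) ->
  (forall i (a : int), c i *~ a \in L <-> (d i %| a)%Z) ->
  (forall a : {poly int}, u a = 0 <-> forall i, (d i %| a`_i)%Z) -> False.
Proof.
move=> GB [r rL] e_surj eL cL ker_u.
have [|LX LXE] := @subgroup_of_prop {poly rat} (fun q => forall k, q`_k \in L).
  split=> [k|x y xL yL k]; first by rewrite coef0 rpred0.
  by rewrite coefB rpredB.
pose pi := quotient_map LX.
have divD : divisible (Quotient.quot LX).
  move=> n q n_gt0; have [f <-] := quotient_map_surj q.
  exists (pi (n%:R^-1 *: f)); rewrite -raddfMn /= -scaler_nat scalerA.
  by rewrite divff ?scale1r // pnatr_eq0 -lt0n.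
have [s0 s0E] := poly_lift e.
have [j0 j0E] := poly_lift (fun i => c i *: 'X^i).
have j0_coef a k : (j0 a)`_k = c k *~ a`_k.
  rewrite (j0E a (maxn (size a) k.+1)) ?leq_maxl // coef_sum.
  have kn : (k < maxn (size a) k.+1)%N by rewrite leq_maxr.
  rewrite (bigD1 (Ordinal kn)) //= big1 ?addr0.
    by rewrite coefMrz coefZ coefXn eqxx mulr1.
  move=> i /eqP ik; rewrite coefMrz coefZ coefXn.
  case: eqP => [ki|_]; last by rewrite mulr0 mul0rz.
  by case: ik; apply: val_inj.
have s_surj q : exists v, (pi \o s0 : {additive _ -> _}) v = q.
  have [f <-] := quotient_map_surj q; have [i <-] := e_surj f.
  by exists 'X^i; rewrite /= (poly_liftXn s0E).
have ker_us a : u a = 0 -> (pi \o s0 : {additive _ -> _}) a = 0.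
  move/ker_u => da; apply/quotient_map_eq0/LXE => k.
  rewrite (s0E a _ (leqnn _)) coef_sum rpred_sum // => i _.
  have /dvdzP[m ->] := da i.
  by rewrite coefMrz mulrC mulrzA rpredMz // -pmulrn.
have ker_j a : (pi \o j0 : {additive _ -> _}) a = 0 <-> u a = 0.
  rewrite ker_u /= quotient_map_eq0 LXE.
  by split=> h i; move: (h i); rewrite ?j0_coef; move/cL.
have [b bE] := generalized_Bassian_section GB divD s_surj ker_us ker_j.
(* [b q] is divisible by every positive integer inside the image of [u]. *)
have b0 q : b q = 0.
  have [v vE] := s_surj q; have [w sw bv] := bE v.
  rewrite -vE bv; apply/ker_u => i; set a := v - w in bv *.
  have dvd_mod m : (0 < m)%N -> exists z : int, (d i %| a`_i - z *+ m)%Z.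
    move=> m_gt0; have [q' q'E] := divD m q m_gt0.
    have [v' v'E] := s_surj q'; have [w' sw' bv'] := bE v'.
    have /ker_u/(_ i) : u (a - (v' - w') *+ m) = 0.
      by rewrite raddfB raddfMn -bv -bv' vE v'E q'E raddfMn subrr.
    by rewrite coefB coefMn; exists (v' - w')`_i.
  have [di0|di_gt0] := posnP (d i); last first.
    have [z] := dvd_mod _ di_gt0.
    by rewrite -mulr_natr rpredBr ?dvdz_mull // natz.
  have [z] := dvd_mod (absz a`_i).+1 isT.
  rewrite di0 dvd0z subr_eq0 => /eqP aE.
  have := congr1 absz aE; rewrite -mulr_natr abszM natz /=.
  case: `|z|%N => [|n] /eqP; first by rewrite mul0n absz_eq0 dvd0z.
  by rewrite mulSn addSn ltn_eqF // ltnS leq_addr.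
have [v vE] := s_surj (pi r%:P).
have [w sw] := bE v; rewrite b0 => /esym/ker_us.
rewrite raddfB sw subr0 vE => /quotient_map_eq0/LXE/(_ 0%N).
by rewrite coefC eqxx (negPf rL).
Qed.

(** * Finite rank and independent families in the socle *)

Definition finitely_many (T : choiceType) (S : T -> Prop) : Prop :=
  exists s : seq T, forall x, S x -> x \in s.

Definition no_infinite_free (G : zmodType) : Prop :=
  forall u : {additive {poly int} -> G}, exists2 a, a != 0 & u a = 0.

Lemma enumerate_poly_rat : exists e : nat -> {poly rat}, forall q, exists i, e i = q.
Proof.
by exists (fun i => odflt 0 (unpickle i)) => q; exists (pickle q); rewrite pickleK.
Qed.

(** The case [L = 0] and [d = 0]: the divisible group is [Q[X]], which is a
    quotient of a free group of countable rank and contains one. *)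
Lemma generalized_Bassian_no_infinite_free (G : zmodType) :
  generalized_Bassian G -> no_infinite_free G.
Proof.
move=> GB u; apply: contrapT => inj.
have [e e_surj] := enumerate_poly_rat.
have [|L LE] := @subgroup_of_prop rat (fun r => r = 0).
  by split=> // _ _ -> ->; rewrite subrr.
apply: (@generalized_Bassian_no_scattered_sum G L e (fun=> 0%N) (fun=> 1) u) => //.
- by exists 1; apply/negP => /LE/eqP; rewrite oner_eq0.
- by move=> i k; rewrite mulr0n rpred0.
- by move=> i a; rewrite LE dvd0z; split=> [/eqP|/eqP->//]; rewrite intr_eq0.
- move=> a; split=> [ua0 i|a0].
    rewrite dvd0z; apply/eqP; have [->|a_neq0] := eqVneq a 0; first by rewrite coef0.
    by case: inj; exists a.
  have -> : a = 0 by apply/polyP => i; rewrite coef0; apply/eqP; rewrite -dvd0z.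
  by rewrite raddf0.
Qed.

(** The layer [p^k G] of the [p]-socle. *)
Definition socle_layer (G : zmodType) (p k : nat) (z : G) : Prop :=
  z *+ p = 0 /\ exists y, z = y *+ (p ^ k).

Lemma mulrz_modz (G : zmodType) (p : nat) (z : G) (b : int) :
  (0 < p)%N -> z *+ p = 0 -> exists2 j, (j < p)%N & z *~ b = z *+ j.
Proof.
move=> p_gt0 zp; exists (absz (b %% p)%Z).
  by rewrite -ltz_nat gez0_abs ?modz_ge0 ?ltz_pmod // -lt0n.
rewrite {1}(divz_eq b p) mulrzDr mulrC mulrzA -pmulrn zp mul0rz add0r.
by rewrite pmulrn gez0_abs // modz_ge0 // -lt0n.
Qed.

(** Each new element of the socle is taken outside the finite subgroup spanned by
    [V] and the previous ones.  What is returned are the elements [y i] whose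
    multiples by [p ^ k i] form this family. *)
Lemma independent_sequence (G : zmodType) (p : nat) (k : nat -> nat)
    (V : zmodClosed G) :
  prime p -> finitely_many (fun x => x \in V) ->
  (forall i, ~ finitely_many (@socle_layer G p (k i))) ->
  exists y : nat -> G, (forall i, y i *+ (p ^ (k i).+1) = 0) /\
    forall n (b : nat -> int), \sum_(i < n) (y i *+ (p ^ k i)) *~ b i \in V ->
      forall i, (i < n)%N -> (p %| b i)%Z.
Proof.
move=> p_pr [sV sVE] inf; have p_gt0 := prime_gt0 p_pr.
have /choice[Y YE] (iL : nat * seq G) :
    exists y, (y *+ (p ^ k iL.1)) *+ p = 0 /\ y *+ (p ^ k iL.1) \notin iL.2.
  case: iL => i L; apply: contrapT => none; apply: (inf i); exists L.
  move=> x [xp [y xE]]; apply: contrapT => /negP xL.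
  by apply: none; exists y; rewrite -xE.
(* [L i] lists the subgroup generated by V and the first i socle elements. *)
pose L := fix L n := if n is i.+1 then
  [seq l + (Y (i, L i) *+ (p ^ k i)) *+ j | l <- L i, j <- iota 0 p] else sV.
pose y i := Y (i, L i); pose z i := y i *+ (p ^ k i).
have zp i : z i *+ p = 0 by case: (YE (i, L i)).
have zL i : z i \notin L i by case: (YE (i, L i)).
have span_L n v (b : nat -> int) :
    v \in V -> v + \sum_(i < n) z i *~ b i \in L n.
  move=> vV; elim: n => [|n IH]; first by rewrite big_ord0 addr0 sVE.
  have [j jp jE] := mulrz_modz (b n) p_gt0 (zp n).
  rewrite big_ord_recr /= addrA jE; apply/allpairsP.
  by exists (v + \sum_(i < n) z i *~ b i, j); rewrite mem_iota.
exists y; split=> [i|n b]; first by rewrite expnSr mulrnA; apply: zp.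
elim: n => [//|n IH]; rewrite big_ord_recr /= -/(z n).
have [/dvdzP[m mE]|pNb] := boolP (p %| b n)%Z.
  rewrite {1}mE mulrC mulrzA -pmulrn zp mul0rz addr0 => /IH h i.
  rewrite ltnS leq_eqVlt => /orP[/eqP->|]; last exact: h.
  by rewrite mE dvdz_mull.
move=> sV'; case/negP: (zL n).
have : coprimez (b n) p by rewrite coprimezE coprime_sym prime_coprime.
move=> /coprimezP[[a1 a2] /= bez].
have -> : z n = (\sum_(i < n) z i *~ b i + z n *~ b n) *~ a1 +
    \sum_(i < n) z i *~ (- (a1 * b i)).
  have -> : \sum_(i < n) z i *~ (- (a1 * b i)) = - (\sum_(i < n) z i *~ b i) *~ a1.
    rewrite -sumrN mulrz_suml; apply: eq_bigr => i _.
    by rewrite mulrNz mulNrz mulrC mulrzA.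
  rewrite mulrzDl mulNrz addrAC subrr add0r -mulrzA mulrC -[LHS]mulr1z -bez.
  by rewrite mulrzDr [(a2 * _)]mulrC [z n *~ (p%:Z * _)]mulrzA -pmulrn zp mul0rz addr0.
by apply: (span_L n _ (fun i => - (a1 * b i))); rewrite rpredMz.
Qed.

(** A sum of cyclic groups is controlled by its socle: if a combination of the
    [y i] lies in [M], multiply it by the largest power of [p] that does not
    annihilate all its terms; the result is a combination of socle elements in
    [M], and independence modulo the socle of [M] applies. *)
Lemma independent_poly_map (G : zmodType) (p : nat) (k : nat -> nat)
    (M : zmodClosed G) :
  prime p -> finitely_many (fun x => x \in M /\ x *+ p = 0) ->
  (forall i, ~ finitely_many (@socle_layer G p (k i))) ->
  exists u : {additive {poly int} -> G},
    (forall a : {poly int},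
       (forall i, ((p ^ (k i).+1)%:Z %| a`_i)%Z) -> u a = 0) /\
    (forall a : {poly int},
       u a \in M -> forall i, ((p ^ (k i).+1)%:Z %| a`_i)%Z).
Proof.
move=> p_pr fin inf; have p_gt0 := prime_gt0 p_pr.
have [|V VE] := @subgroup_of_prop G (fun x => x \in M /\ x *+ p = 0).
  split=> [|x y [xM xp] [yM yp]]; first by rewrite rpred0 mul0rn.
  by rewrite rpredB // mulrnBl xp yp subrr.
have [|y [y0 y_ind]] := @independent_sequence G p k V p_pr _ inf.
  by case: fin => s sE; exists s => x /VE/sE.
have [u uE] := poly_lift y; exists u; split=> a.
  move=> da; rewrite (uE a _ (leqnn _)) big1 // => i _.
  by have /dvdzP[m ->] := da i; rewrite mulrC mulrzA -pmulrn y0 mul0rz.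
move=> uM; pose n := size a.
have small e : (forall i, (i < n)%N -> ((p ^ (k i).+1)%:Z %| (p ^ e)%:Z * a`_i)%Z) ->
    forall i, (i < n)%N -> ((p ^ (k i).+1)%:Z %| a`_i)%Z.
  elim: e => [h i|e IH h]; first by move/h; rewrite expn0 mul1r.
  apply: IH.
  have /choice[b bE] i : exists b, (i < n)%N -> (p ^ e)%:Z * a`_i = (p ^ k i)%:Z * b.
    have [lt_in|] := ltnP i n; last by exists 0.
    have : ((p ^ k i)%:Z %| (p ^ e)%:Z * a`_i)%Z.
      by have := h i lt_in; rewrite !dvdzE !abszM /= !expnS -mulnA dvdn_pmul2l.
    by case/dvdzP=> b ->; exists b; rewrite mulrC.
  have /y_ind b_dvd : \sum_(i < n) y i *+ (p ^ k i) *~ b i \in V.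
    have -> : \sum_(i < n) y i *+ (p ^ k i) *~ b i = u a *+ (p ^ e).
      rewrite (uE a n) // -sumrMnl; apply: eq_bigr => i _.
      by rewrite !pmulrn -!mulrzA -bE // mulrC.
    apply/VE; split; first exact: rpredMn.
    rewrite -mulrnA -expnSr -raddfMn /= (uE _ n); last first.
      by rewrite -scaler_nat (leq_trans (size_scale_leq _ _)).
    rewrite big1 // => i _; rewrite coefMn -mulr_natl natz.
    have /dvdzP[m ->] := h i (ltn_ord i).
    by rewrite mulrC mulrzA -pmulrn y0 mul0rz.
  move=> i lt_in; rewrite bE // expnSr PoszM; apply: dvdz_mul => //.
  exact: b_dvd.
move=> i; have [lt_in|?] := ltnP i n; last by rewrite nth_default ?dvdz0.
apply: (small (\sum_(i < n) (k i).+1)%N) => // {}i {}lt_in.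
apply: dvdz_mulr; rewrite dvdzE /= dvdn_exp2l //.
by rewrite (bigD1 (Ordinal lt_in)) //= leq_addr.
Qed.

(** * The socle layers of a generalized Bassian group *)

Lemma in_Zloc_divX (p n : nat) (a : int) : prime p ->
  a%:~R / (p ^ n)%:R \in in_Zloc p <-> ((p ^ n)%:Z %| a)%Z.
Proof.
move=> p_pr; have pn_neq0 : (p ^ n)%:R != 0 :> rat.
  by rewrite pnatr_eq0 -lt0n expn_gt0 prime_gt0.
split=> [/in_ZlocP[m [k [k_gt0 cop /eqP]]]|/dvdzP[m ->]]; last first.
  by apply/in_ZlocP; exists m, 1%N; rewrite coprimen1 rmorphM /= mulfK // divr1.
rewrite eqr_div // ?pnatr_eq0 -?lt0n // !pmulrn -!intrM eqr_int => /eqP E.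
have cop' : coprimez (p ^ n)%:Z k%:Z by rewrite coprimezE /= coprimeXl.
by rewrite -(Gauss_dvdzl _ cop') E dvdz_mull.
Qed.

(** The exponent is taken positive so that it can serve as the exponent of the
    order of a nonzero cyclic summand. *)
Lemma in_Zloc_multiple (p : nat) (q : {poly rat}) : prime p ->
  exists n, forall k, q`_k *+ (p ^ n.+1) \in in_Zloc p.
Proof.
move=> p_pr.
have rat_multiple (r : rat) : exists n, r *+ (p ^ n) \in in_Zloc p.
  have den_gt0 : (0 < `|denq r|)%N by rewrite absz_gt0 denq_neq0.
  have [m cop mE] := pfactor_coprime p_pr den_gt0.
  have m_gt0 : (0 < m)%N by move: den_gt0; rewrite mE muln_gt0 => /andP[].
  exists (logn p `|denq r|); apply/in_ZlocP; exists (numq r), m; split=> //.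
  have pl_neq0 : (p ^ logn p `|denq r|)%:R != 0 :> rat.
    by rewrite pnatr_eq0 -lt0n expn_gt0 prime_gt0.
  rewrite -{1}[r]divq_num_den -[X in _ / X%:~R]absz_denq.
  rewrite -pmulrn {1}mE natrM invfM mulrA -[LHS]mulr_natr mulfVK // mul1r.
have : exists n, forall k, q`_k *+ (p ^ n) \in in_Zloc p.
  elim/poly_ind: q => [|q c [n nE]]; first by exists 0%N => k; rewrite coef0 mul0rn rpred0.
  have [m mE] := rat_multiple c; exists (n + m)%N => k.
  rewrite coefD coefMX coefC mulrnDl expnD; apply: rpredD; case: (k == 0%N).
  - by rewrite mul0rn rpred0.
  - by rewrite mulrnA rpredMn.
  - by rewrite mulnC mulrnA rpredMn.
  - by rewrite mul0rn rpred0.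
by case=> n nE; exists n => k; rewrite expnSr mulrnA rpredMn.
Qed.

(** If all layers were infinite, one could find independent cyclic subgroups of
    any prescribed orders [p ^ (n i).+1].  These orders are chosen large enough
    for the sum to map onto [(Q / Z_(p))[X]], enumerated by [e]. *)
Lemma generalized_Bassian_finite_layer (G : zmodType) (p : nat) :
  prime p -> generalized_Bassian G ->
  exists k, finitely_many (@socle_layer G p k).
Proof.
move=> p_pr GB; apply: contrapT => /forallNP inf.
have [e e_surj] := enumerate_poly_rat.
have /choice[n nE] i := in_Zloc_multiple (e i) p_pr.
have [|M ME] := @subgroup_of_prop G (fun x => x = 0).
  by split=> // _ _ -> ->; rewrite subrr.
have [|i|u [ker1 ker2]] := @independent_poly_map G p n M p_pr; last 1 first.
- apply: (@generalized_Bassian_no_scattered_sum G (in_Zloc p) e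
    (fun i => p ^ (n i).+1)%N (fun i => (p ^ (n i).+1)%:R^-1) u GB) => //.
  + exists (1%:~R / (p ^ 1)%:R); apply/negP => /(in_Zloc_divX _ _ p_pr).
    by rewrite dvdzE /= dvdn1 expn1 => /eqP p1; move: p_pr; rewrite p1.
  + by move=> i a; rewrite -(in_Zloc_divX _ _ p_pr) -mulrzr mulrC.
  + by move=> a; split=> [ua|]; [apply: ker2; apply/ME|exact: ker1].
- by exists [:: 0] => x [/ME-> _]; rewrite inE.
- exact: inf.
Qed.

(** Otherwise independent elements of layer [k], modulo layer [k + 1], give a sum
    [H] of cyclic groups of order [p ^ k.+1], disjoint from [p ^ k.+1 G] and
    hence a summand.  Shifting the generators of [H] embeds [G] in [G / N],
    where [N] is the socle of the first cyclic factor.  But [N] lies in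
    [p ^ k G] with [k > 0], so it is not a summand. *)
Lemma generalized_Bassian_layer_step (G : zmodType) (p k : nat) :
  prime p -> generalized_Bassian G -> (0 < k)%N ->
  finitely_many (@socle_layer G p k.+1) -> finitely_many (@socle_layer G p k).
Proof.
move=> p_pr GB k_gt0 fin; apply: contrapT => inf.
(* The socle of [M = p ^ k.+1 G] is the finite layer. *)
have [|M ME] := @subgroup_of_prop G (fun x => exists y, x = y *+ (p ^ k.+1)).
  split; first by exists 0; rewrite mul0rn.
  by move=> _ _ [x ->] [y ->]; exists (x - y); rewrite mulrnBl.
have [|//|u [ker1 ker2]] := @independent_poly_map G p (fun=> k) M p_pr.
  by case: fin => s sE; exists s => x [/ME xM xp]; apply: sE.
have m_gt0 : (0 < p ^ k.+1)%N by rewrite expn_gt0 prime_gt0.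
have ker a : u a = 0 -> forall i, ((p ^ k.+1)%:Z %| a`_i)%Z.
  by move=> ua; apply: ker2; rewrite ua rpred0.
have [|H HE] := @subgroup_of_prop G (fun x => exists a, x = u a).
  split; first by exists 0; rewrite raddf0.
  by move=> _ _ [a ->] [b ->]; exists (a - b); rewrite raddfB.
have [|n1 n2 _ nE /HE[a ->]||C [_ dsum]] := @bounded_complement G _ H M m_gt0.
- by move=> x; apply/ME; exists x.
- rewrite -raddfMn /= => /ker an1.
  have /choice[b bE] i : exists b : int, a`_i = b * n2.
    have := an1 i; rewrite coefMn -nE -mulr_natr natz mulrC PoszM.
    case/dvdzP=> b bE; exists b; apply: (@mulIf _ n1%:Z).
      by move: m_gt0; rewrite -nE muln_gt0 => /andP[]; rewrite lt0n.
    by rewrite [LHS]mulrC bE mulrA mulrAC.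
  exists (u (\poly_(i < size a) b i)); first by apply/HE; exists (\poly_(i < size a) b i).
  rewrite -raddfMn; congr (u _); apply/polyP => i.
  rewrite coefMn coef_poly -mulr_natr natz.
  by case: ltnP => [_|ai]; [rewrite bE|rewrite nth_default ?mul0r].
- move=> _ /ME[x ->] /HE[a xa]; rewrite xa; apply: ker1; apply: ker2.
  by apply/ME; exists x.
have [|N NE] := @subgroup_of_prop G (fun x => exists b : int, x = u (b%:P) *+ (p ^ k)).
  split; first by exists 0; rewrite raddf0 mul0rn.
  by move=> _ _ [b ->] [c ->]; exists (b - c); rewrite polyCB raddfB mulrnBl.
pose src := ({poly int} * subgroup_type C)%type.
have [|sm smE] := @additive_of_fun src G (fun x => u x.1 + val x.2).
  by move=> x y /=; rewrite !raddfB /= opprD addrACA.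
(* Multiplication by ['X] is the shift of the generators of [H]. *)
have [|sh shE] := @additive_of_fun src (Quotient.quot N)
    (fun x => quotient_map N (u ('X * x.1) + val x.2)).
  move=> x y; rewrite -[RHS]raddfB; congr (quotient_map N _).
  by rewrite /= mulrBr !raddfB /= opprD addrACA.
have [sumHC disHC] := dsum.
have sm_surj x : exists v, sm v = x.
  have [_ [c [/HE[a ->] cC ->]]] := sumHC x.
  by exists (a, SubgroupElt cC); rewrite smE.
have split0 a (c : subgroup_type C) : u a + val c = 0 -> u a = 0 /\ val c = 0.
  move=> /eqP; rewrite addr_eq0 => /eqP uac.
  have ua0 : u a = 0.
    by apply: disHC; [apply/HE; exists a|rewrite uac rpredN; exact: valP].
  by split=> //; apply/eqP; rewrite -oppr_eq0 -uac ua0.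
have [[a c]|phi phiE] := @factor_additive src _ _ sm sh sm_surj.
  rewrite smE shE => /split0[/= /ker ka ->]; rewrite addr0 ker1 ?raddf0 // => i.
  by rewrite coefXM; case: eqP.
have phi_inj : injective phi.
  move=> x y /eqP; rewrite -subr_eq0 -raddfB => /eqP.
  move=> h; apply/eqP; rewrite -subr_eq0; apply/eqP.
  move: (x - y) h => z; have [[a c] <-] := sm_surj z.
  rewrite phiE shE smE /= => /quotient_map_eq0/NE[b /eqP].
  rewrite -subr_eq0 addrAC -raddfMn -raddfB => /eqP/split0[/ker ka ->].
  rewrite addr0 ker1 // => i; have := ka i.+1.
  by rewrite coefB coefXM coefMn coefC mul0rn subr0.
have [B [sumNB disNB]] := GB N (ex_intro _ phi phi_inj).
have [_ [b [/NE[c ->] bB xE]]] := sumNB (u 1).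
have u0 : u 1 *+ (p ^ k) = 0.
  apply: disNB; first by apply/NE; exists 1.
  rewrite xE mulrnDl -mulrnA -expnD -raddfMn /= ker1 ?add0r ?rpredMn // => i.
  (* [p ^ (k + k)] kills [H] because [k >= 1]. *)
  rewrite coefMn -mulr_natl natz dvdz_mulr // dvdzE /= dvdn_exp2l //.
  by rewrite -addn1 leq_add2l.
have upk : u (1 *+ (p ^ k)) = 0 by rewrite raddfMn /= u0.
have := ker _ upk 0%N.
by rewrite coefMn coef1 natz dvdzE /= dvdn_Pexp2l ?prime_gt1 // ltnn.
Qed.

(** * Finiteness of the multiples of the primary components *)

(** A set is finite when finitely many labels suffice and elements with a common
    label differ by an element of a finite set. *)
Lemma finitely_many_fibers (G : zmodType) (I : choiceType) (X K : G -> Prop)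
    (lab : G -> I -> Prop) (s : seq I) :
  finitely_many K ->
  (forall x, X x -> exists2 i, i \in s & lab x i) ->
  (forall x y i, X x -> X y -> lab x i -> lab y i -> K (x - y)) ->
  finitely_many X.
Proof.
move=> [sK sKE] labX fib.
have /choice[r rE] i : exists r, forall x, X x -> lab x i -> X r /\ lab r i.
  have [[x [Xx xi]]|none] := pselect (exists x, X x /\ lab x i); first by exists x.
  by exists 0 => x Xx xi; case: none; exists x.
exists [seq r i + k | i <- s, k <- sK] => x Xx.
have [i si xi] := labX x Xx; have [Xr ri] := rE i x Xx xi.
apply/allpairsP; exists (i, x - r i); split=> //=; last by rewrite addrC subrK.
by apply: sKE; apply: fib xi ri.
Qed.

(** Multiplication by an integer prime to [p] is invertible on a primary element,
    by the Chinese remainder theorem. *)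
Lemma primary_mulrn_inverse (G : zmodType) (p m : nat) (x : G) :
  prime p -> coprime p m -> in_primary_component p x ->
  exists c, x = x *+ c *+ m.
Proof.
move=> p_pr cop [e xe0]; have [e0|e_gt0] := posnP e.
  by exists 0%N; move: xe0; rewrite e0 mulr1n => ->; rewrite !mul0rn.
have cop' : coprime (p ^ e) m by rewrite coprime_pexpl.
exists (chinese (p ^ e) m 1 0 %/ m)%N.
have /dvdnP[d dE] : (m %| chinese (p ^ e) m 1 0)%N.
  by rewrite /dvdn chinese_modr // mod0n.
rewrite -mulrnA dE mulnK; last first.
  by case: m cop {cop' dE} => //; rewrite /coprime gcdn0 => /eqP p1; rewrite p1 in p_pr.
rewrite -dE (divn_eq (chinese _ _ _ _) (p ^ e)) mulrnDr mulnC mulrnA xe0 mul0rn add0r.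
rewrite chinese_modl // modn_small ?mulr1n //.
by rewrite -{1}(expn0 p) ltn_exp2l // prime_gt1.
Qed.

(** Multiplication by [p] maps [Q] onto itself, so [generalized_Bassian_section]
    applies with the identity as embedding.  The lift [b] satisfies
    [b (p q) = q - w] with [p w = 0]; if [p q] is in the socle, applying [p]
    gives [p q = b (p (p q)) = 0].  So the socle of [Q] is zero. *)
Lemma generalized_Bassian_reduced (G : zmodType) (p : nat) (Q : zmodClosed G) :
  prime p -> generalized_Bassian G ->
  (forall x, x \in Q -> in_primary_component p x) ->
  (forall x, x \in Q -> exists2 y, y \in Q & x = y *+ p) ->
  forall x, x \in Q -> x = 0.
Proof.
move=> p_pr GB prim div_p.
have div_pn n x : x \in Q -> exists2 y, y \in Q & x = y *+ (p ^ n).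
  elim: n x => [|n IH] x xQ; first by exists x.
  have [y /IH[z zQ ->] ->] := div_p x xQ.
  by exists z; rewrite // -mulrnA expnSr.
pose D := subgroup_type Q.
have divD : divisible D.
  move=> n [x xQ] n_gt0; have [m cop] := pfactor_coprime p_pr n_gt0.
  move: (logn p n) => l nE; have [y yQ xE] := div_pn l x xQ.
  have [c yE] := primary_mulrn_inverse p_pr cop (prim y yQ).
  exists (SubgroupElt yQ *+ c); apply: val_inj; rewrite !raddfMn /= xE {1}yE.
  by rewrite nE -!mulrnA mulnA.
have [|s sE] := @additive_of_fun D D (fun x => x *+ p).
  by move=> x y; rewrite mulrnBl.
have [d|v v0|v|b bE] := @generalized_Bassian_section G D D
    (val : {additive D -> G}) s idfun GB divD.
- by have [v ->] := divD p d (prime_gt0 p_pr); exists v; rewrite sE.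
- have -> : v = 0 by apply: val_inj; rewrite v0 raddf0.
  by rewrite raddf0.
- by split=> v0; [rewrite (v0 : v = 0) raddf0|apply: val_inj; rewrite v0 raddf0].
have socle0 y : y \in Q -> y *+ p = 0 -> y = 0.
  move=> yQ yp; have [q qQ yE] := div_p y yQ.
  have [w] := bE (SubgroupElt qQ); rewrite !sE => wp bq.
  have q0 : SubgroupElt qQ *+ p *+ p = 0.
    by apply: val_inj; rewrite !raddfMn raddf0 /= -yE.
  have : val (SubgroupElt qQ *+ p) = b (SubgroupElt qQ *+ p *+ p).
    by rewrite [in RHS]raddfMn bq -raddfMn mulrnBl wp subr0.
  by rewrite q0 raddf0 raddfMn /= -yE.
move=> x xQ; have [e] := prim x xQ; elim: e => [|e IH]; first by rewrite mulr1n.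
by rewrite expnSr mulrnA => /socle0 xe; apply: IH; apply: xe; rewrite rpredMn.
Qed.

Lemma socle_layerW (G : zmodType) (p k l : nat) (z : G) :
  (k <= l)%N -> socle_layer p l z -> socle_layer p k z.
Proof.
move=> kl [zp [y yE]]; split=> //.
by exists (y *+ (p ^ (l - k))); rewrite yE -mulrnA -expnD subnK.
Qed.

(** A decreasing sequence of finite sets is eventually constant. *)
Lemma finite_layer_stable (G : zmodType) (p : nat) :
  finitely_many (@socle_layer G p 1) ->
  exists2 k, (0 < k)%N &
    forall l z, @socle_layer G p k z -> socle_layer p l z.
Proof.
case=> s sE.
have /choice[h hE] (z : G) : exists k, socle_layer p k z -> forall l, socle_layer p l z.
  have [all|/existsNP[k Nk]] := pselect (forall l, socle_layer p l z).
    by exists 0%N.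
  by exists k => /Nk.
exists (\max_(z <- s) h z).+1 => // l z zk.
have zs : z \in s by apply: sE; apply: socle_layerW zk.
by apply: hE; apply: socle_layerW zk; rewrite leqW // leq_bigmax_seq.
Qed.

(** The subgroup [p T_p]. *)
Definition primary_multiple (G : zmodType) (p : nat) (x : G) : Prop :=
  exists2 t, in_primary_component p t & x = t *+ p.

Lemma is_subgroup_primary (G : zmodType) (p : nat) :
  is_subgroup (@in_primary_component G p).
Proof.
split=> [|x y [k xk] [l yl]]; first by exists 0%N; rewrite mul0rn.
exists (k + l)%N; rewrite mulrnBl expnD {1}mulrnA xk mul0rn.
by rewrite mulnC mulrnA yl mul0rn subrr.
Qed.

Lemma is_subgroup_primary_multiple (G : zmodType) (p n : nat) :
  is_subgroup (fun x : G => exists2 t, in_primary_component p t & x = t *+ n).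
Proof.
have [P0 PB] := @is_subgroup_primary G p.
split; first by exists 0; rewrite ?mul0rn.
by move=> _ _ [x xp ->] [y yp ->]; exists (x - y); rewrite ?mulrnBl //; apply: PB.
Qed.

(** The first socle layer is finite, by descent from a high one.  Once the layers
    are constant, [p ^ k T_p] is divisible: an element of order [p ^ m.+1] is
    corrected by a multiple of [p] so as to have order [p ^ m].  So
    [p ^ k T_p = 0], and a bounded primary group with finite socle is finite. *)
Lemma generalized_Bassian_finite_primary_multiple (G : zmodType) (p : nat) :
  prime p -> generalized_Bassian G -> finitely_many (@primary_multiple G p).
Proof.
move=> p_pr GB.
have fin1 : finitely_many (@socle_layer G p 1).
  have [k] := generalized_Bassian_finite_layer p_pr GB.
  elim: k => [[s sE]|k IH fin].
    by exists s => z zl; apply: sE; apply: socle_layerW zl.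
  have [k0|k_gt0] := posnP k; first by rewrite k0 in fin.
  exact/IH/generalized_Bassian_layer_step.
have [k k_gt0 stable] := finite_layer_stable fin1.
have [Q QE] := subgroup_of_prop (@is_subgroup_primary_multiple G p (p ^ k)).
have Q0 : forall x, x \in Q -> x = 0.
  apply: (generalized_Bassian_reduced p_pr GB) => [_ /QE[t [e te] ->]|x].
    by exists e; rewrite -mulrnA mulnC mulrnA te mul0rn.
  move=> xQ; have [m xm] : in_primary_component p x.
    by case/QE: xQ => t [e te] ->; exists e; rewrite -mulrnA mulnC mulrnA te mul0rn.
  elim: m x xm xQ => [|m IH] x xm xQ.
    by exists 0; rewrite ?rpred0 // mul0rn -(mulr1n x).
  have /(stable (k + m).+1)[_ [y xy]] : socle_layer p k (x *+ (p ^ m)).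
    split; first by rewrite -mulrnA -expnSr.
    by case/QE: xQ => t _ ->; exists (t *+ (p ^ m)); rewrite -!mulrnA mulnC.
  have yQ : y *+ (p ^ k) \in Q.
    apply/QE; exists y => //; exists ((k + m).+1 + 1)%N.
    by rewrite expnD mulrnA -xy expn1 -mulrnA -expnSr.
  have [||z zQ zE] := IH (x - y *+ (p ^ k) *+ p).
  - by rewrite mulrnBl xy -!mulrnA -expnS -expnD addnS subrr.
  - by apply: rpredB => //; apply: rpredMn.
  exists (z + y *+ (p ^ k)); first exact: rpredD.
  by rewrite mulrnDl -zE subrK.
have bounded (t : G) : in_primary_component p t -> t *+ (p ^ k) = 0.
  by move=> tp; apply: Q0; apply/QE; exists t.
suff fin m : finitely_many (fun x : G => primary_multiple p x /\ x *+ (p ^ m) = 0).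
  have [s sE] := fin k; exists s => x xp; apply: sE; split=> //.
  by case: xp => t tp ->; rewrite -mulrnA mulnC mulrnA bounded // mul0rn.
elim: m => [|m [s sE]].
  by exists [:: 0] => x [_]; rewrite mulr1n inE => ->.
apply: (@finitely_many_fibers _ _ _ _ (fun x y => x *+ p = y) s fin1).
  move=> x [[t tp xE] xm]; exists (x *+ p) => //; apply: sE; split.
    exists x => //; case: tp => e te; exists e.
    by rewrite xE -mulrnA mulnC mulrnA te mul0rn.
  by rewrite -mulrnA -expnS.
move=> x y z [[t _ ->] _] [[t' _ ->] _] <- zE; split.
  by rewrite mulrnBl zE subrr.
by exists (t - t'); rewrite mulrnBl.
Qed.

(** * A splitting criterion for torsion subgroups *)

(** Divide the order by its prime factors one at a time, up to the last nonzero
    multiple. *)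
Lemma torsion_prime_multiple (G : zmodType) (x : G) (n : nat) :
  (0 < n)%N -> x *+ n = 0 -> x <> 0 ->
  exists p j, [/\ prime p, x *+ j <> 0 & x *+ j *+ p = 0].
Proof.
move=> n_gt0 xn x0; elim/ltn_ind: n n_gt0 xn => n IH n_gt0 xn.
have n_neq1 : n != 1%N by apply/eqP => n1; apply: x0; rewrite -[x]mulr1n -n1.
have p_pr : prime (pdiv n) by rewrite pdiv_prime // ltn_neqAle eq_sym n_neq1.
have nE : (n %/ pdiv n * pdiv n = n)%N by rewrite divnK // pdiv_dvd.
have [xj|xj] := eqVneq (x *+ (n %/ pdiv n)) 0; last first.
  by exists (pdiv n), (n %/ pdiv n)%N; split=> //; [apply/eqP|rewrite -mulrnA nE].
apply: (IH (n %/ pdiv n)%N) => //; first by rewrite ltn_Pdiv // prime_gt1.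
by rewrite divn_gt0 ?prime_gt0 // dvdn_leq // pdiv_dvd.
Qed.

(** For each prime [p] the socle of [N] is a vector space that embeds in
    [G / p G], and in [G / (p G + F)] when [p] does not divide [k], so it has a
    complement [C p] containing [p G] or [p G + F].  The complement of [N] is the
    intersection of all [C p]. *)
Lemma direct_summand_of_primewise (G : zmodType) (F N : zmodClosed G) (k : nat) :
  (0 < k)%N ->
  (forall x : G, exists2 n, (0 < n)%N & x *+ n \in F) ->
  (forall x, x \in N -> exists2 n, (0 < n)%N & x *+ n = 0) ->
  (forall p x, prime p -> x \in N -> x *+ p = 0 ->
    (exists g, x = g *+ p) -> x = 0) ->
  (forall p x, prime p -> ~~ (p %| k)%N -> x \in N -> x *+ p = 0 ->
    (exists g, exists2 f, f \in F & x = g *+ p + f) -> x = 0) ->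
  direct_summand N.
Proof.
move=> k_gt0 qe torN pureN avoidF.
have [C CE] : exists C : nat -> zmodClosed G, forall p, prime p ->
    [/\ forall g, g *+ p \in C p,
        ~~ (p %| k)%N -> {subset F <= C p},
        forall x, x \in N -> x *+ p = 0 -> x \in C p -> x = 0
      & forall x, exists n, [/\ n \in N, n *+ p = 0 & x - n \in C p]].
  suff /choice[C CE] : forall p, exists C : zmodClosed G, prime p ->
      [/\ forall g, g *+ p \in C, ~~ (p %| k)%N -> {subset F <= C},
          forall x, x \in N -> x *+ p = 0 -> x \in C -> x = 0
        & forall x, exists n, [/\ n \in N, n *+ p = 0 & x - n \in C]].
    by exists C.
  move=> p; have [p_pr|/negP pNpr] := boolP (prime p); last by exists N.
  have [|H HE] := @subgroup_of_prop G (fun x => x \in N /\ x *+ p = 0).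
    split=> [|x y [xN xp] [yN yp]]; first by rewrite rpred0 mul0rn.
    by rewrite rpredB // mulrnBl xp yp subrr.
  have [|C0 C0E] := @subgroup_of_prop G (fun x => exists g f,
      [/\ f \in F, (p %| k)%N -> f = 0 & x = g *+ p + f]).
    split; first by exists 0, 0; rewrite rpred0 mul0rn addr0.
    move=> _ _ [g [f [fF f0 ->]]] [g' [f' [f'F f'0 ->]]].
    exists (g - g'), (f - f'); split; first exact: rpredB.
      by move=> pk; rewrite f0 ?f'0 ?subrr.
    by rewrite mulrnBl opprD addrACA.
  have [x|n1 n2 h n12 /HE[hN hp] hn1|x /C0E[g [f [fF f0 xE]]] /HE[xN xp]|]
      := @bounded_complement G p H C0 (prime_gt0 p_pr).
  - by apply/C0E; exists x, 0; rewrite rpred0 addr0.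
  - have /primeP[_ /(_ n1)] := p_pr; rewrite -{1}n12 dvdn_mulr // => /(_ erefl).
    case/orP=> /eqP n1E; last first.
      exists h; first by apply/HE.
      have -> : n2 = 1%N; last by rewrite mulr1n.
      by apply/eqP; rewrite -(eqn_pmul2l (prime_gt0 p_pr)) muln1 -{1}n1E n12.
    by move: hn1; rewrite n1E mulr1n => ->; exists 0; rewrite ?rpred0 ?mul0rn.
  - have [pk|pNk] := boolP (p %| k)%N.
      by apply: pureN xp _ => //; exists g; rewrite xE f0 ?addr0.
    by apply: avoidF xp _ => //; exists g, f.
  move=> C [C0C [sumHC disHC]]; exists C => _; split.
  - by move=> g; apply/C0C/C0E; exists g, 0; rewrite rpred0 addr0.
  - move=> pNk f fF; apply/C0C/C0E; exists 0, f; split=> //; last by rewrite mul0rn add0r.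
    by rewrite (negPf pNk).
  - by move=> x xN xp; apply: disHC; apply/HE.
  - move=> x; have [n [c [/HE[nN np] cC ->]]] := sumHC x.
    by exists n; split; rewrite // addrAC subrr add0r.
have [|B BE] := @subgroup_of_prop G (fun x => forall p, prime p -> x \in C p).
  split=> [p _|x y xC yC p p_pr]; first exact: rpred0.
  by apply: rpredB; [exact: xC|exact: yC].
exists B; split; last first.
  move=> x xN /BE xC; apply: contrapT => x0; have [n n_gt0 xn] := torN x xN.
  have [p [j [p_pr xj xjp]]] := torsion_prime_multiple n_gt0 xn x0.
  have [_ _ disC _] := CE p p_pr.
  by apply: xj; apply: disC => //; apply: rpredMn => //; exact: xC.
move=> x; have [m m_gt0 xmF] := qe x.
have /choice[n nE] p : exists n, prime p -> [/\ n \in N, n *+ p = 0 & x - n \in C p].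
  have [p_pr|] := boolP (prime p); last by exists 0.
  by have [_ _ _ /(_ x)[n nE]] := CE p p_pr; exists n.
have n_other p q : prime p -> prime q -> q != p -> n q \in C p.
  move=> p_pr q_pr qp; have [_ nq _] := nE q q_pr.
  have [||c ->] := @primary_mulrn_inverse G q p (n q) q_pr.
  - by rewrite prime_coprime // dvdn_prime2.
  - by exists 1%N; rewrite expn1.
  by have [pC _ _ _] := CE p p_pr; apply: pC.
pose s := \sum_(q <- primes (m * k)) n q.
have primeP q : q \in primes (m * k) -> prime q by rewrite mem_primes => /andP[].
exists s, (x - s); split; last by rewrite addrC subrK.
  rewrite /s big_seq; apply: rpred_sum => q /primeP q_pr.
  by have [] := nE q q_pr.
apply/BE => p p_pr; have [pC FC disC sumC] := CE p p_pr; rewrite /s.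
have [ps|pNs] := boolP (p \in primes (m * k)).
  rewrite (bigD1_seq p) ?primes_uniq //= opprD addrA.
  apply: rpredB; first by have [] := nE p p_pr.
  rewrite big_seq_cond; apply: rpred_sum => q /andP[/primeP q_pr qp].
  exact: n_other.
apply: rpredB; last first.
  rewrite big_seq; apply: rpred_sum => q qs; apply: n_other => //; first exact: primeP.
  by apply: contraNneq pNs => <-.
move: pNs; rewrite mem_primes p_pr muln_gt0 m_gt0 k_gt0 /= Euclid_dvdM // negb_or.
case/andP=> pNm pNk; have [y [yN yp xyC]] := sumC x.
suff y0 : y = 0 by rewrite y0 subr0 in xyC.
have [||c yE] := @primary_mulrn_inverse G p m y p_pr.
- by rewrite prime_coprime.
- by exists 1%N; rewrite expn1.
have ym : y *+ m = 0.
  apply: disC; first exact: rpredMn.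
    by rewrite -mulrnA mulnC mulrnA yp mul0rn.
  have -> : y *+ m = x *+ m - (x - y) *+ m by rewrite mulrnBl opprB addrC subrK.
  by apply: rpredB; [exact: FC|exact: rpredMn].
by rewrite yE -mulrnA mulnC mulrnA ym mul0rn.
Qed.

(** * Finite generation and finite intersections *)

Definition finitely_generated (G : zmodType) (F : zmodClosed G) : Prop :=
  exists e : seq G, (forall i, e`_i \in F) /\
    forall x, x \in F -> exists a : nat -> int,
      x = \sum_(i < size e) e`_i *~ a i.

Lemma injective_sequence (K : choiceType) :
  ~ finitely_many (fun _ : K => True) -> exists g : nat -> K, injective g.
Proof.
move=> inf.
have /choice[Y YE] (L : seq K) : exists x, x \notin L.
  apply: contrapT => none; apply: inf; exists L => x _.
  by apply: contrapT => /negP xL; apply: none; exists x.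
pose L := fix L n := if n is i.+1 then Y (L i) :: L i else [::].
have mem_L i j : (i < j)%N -> Y (L i) \in L j.
  elim: j => // j IH; rewrite ltnS leq_eqVlt inE => /orP[/eqP->|/IH ->].
    by rewrite eqxx.
  by rewrite orbT.
exists (fun i => Y (L i)) => i j ij; have [lt|lt|//] := ltngtP i j.
  by have := YE (L j); rewrite -ij mem_L.
by have := YE (L i); rewrite ij mem_L.
Qed.

(** An infinite basis would contain a sequence, hence span a free subgroup of
    countable rank. *)
Lemma free_subgroup_finitely_generated (G : zmodType) (F : zmodClosed G) :
  free_subgroup F -> no_infinite_free G -> finitely_generated F.
Proof.
case=> K [f [f' fK f'K]] nofree.
have [[s sE]|/injective_sequence[g g_inj]] :=
    pselect (finitely_many (fun _ : K => True)); last first.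
  have [u uE] := poly_lift (fun i => val (f << g i >>)).
  have [a a0] := nofree u; rewrite (uE a _ (leqnn _)) => ua.
  case/eqP: a0; apply/polyP => k; rewrite coef0.
  have [ka|] := ltnP k (size a); last exact: nth_default.
  have D0 : \sum_(i < size a) << g i >> *~ a`_i = 0 :> {freeg K / int}.
    rewrite -[LHS]fK -[RHS]fK; congr f'; apply: val_inj.
    rewrite !raddf0 -[RHS]ua !raddf_sum; apply: eq_bigr => i _.
    by rewrite !raddfMz.
  have := congr1 (coeff (g k)) D0; rewrite raddf0 raddf_sum /=.
  rewrite (bigD1 (Ordinal ka)) //= big1 ?addr0.
    by rewrite freeg_mulz coeffU eqxx mulr1 intz.
  move=> i ik; rewrite freeg_mulz coeffU (inj_eq g_inj).
  have /negPf -> : val i != k by apply: contraNneq ik => ik; apply/eqP/val_inj.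
  by rewrite mulr0.
pose t := undup s; exists [seq val (f << z >>) | z <- t]; split=> [i|x xF].
  have [lt|ge] := ltnP i (size t); last by rewrite nth_default ?size_map ?rpred0.
  have z0 : K by case: (t) lt.
  by rewrite (nth_map z0) //; exact: valP.
pose D := f' (SubgroupElt xF).
have [z0|none] := pselect (exists z : K, True); last first.
  have tE : t = [::] by case: (t) => // z r; case: none; exists z.
  have D0 : D = 0 by apply/eqP/freeg_eqP => z; case: none; exists z.
  exists (fun=> 0); rewrite size_map tE big_ord0.
  have := f'K (SubgroupElt xF); rewrite -/D D0 raddf0 => x0.
  by rewrite -[LHS]/(val (SubgroupElt xF)) -x0 raddf0.
case: z0 => z0 _; exists (fun i => coeff (nth z0 t i) D).
have DE : D = \sum_(i < size t) << nth z0 t i >> *~ coeff (nth z0 t i) D.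
  rewrite -(big_mkord xpredT (fun i => << nth z0 t i >> *~ coeff (nth z0 t i) D)).
  rewrite -(big_nth z0 xpredT (fun z => << z >> *~ coeff z D)).
  apply/eqP/freeg_eqP => z; rewrite raddf_sum /= (bigD1_seq z) ?undup_uniq //=; last first.
    by rewrite mem_undup sE.
  rewrite big1 ?addr0 => [|w /negPf wz]; rewrite freeg_mulz coeffU.
    by rewrite eqxx mulr1 intz.
  by rewrite wz mulr0.
rewrite size_map -[LHS]/(val (SubgroupElt xF)) -[SubgroupElt xF]f'K -/D {1}DE.
rewrite !raddf_sum; apply: eq_bigr => i _.
by rewrite (nth_map z0) // !raddfMz.
Qed.

Definition finite_invariants (G : zmodType) : Prop :=
  no_infinite_free G /\
  forall p, prime p -> finitely_many (@primary_multiple G p).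

(** Two elements of the intersection whose [F]-parts have the same coordinates
    modulo [p] differ by an element of [p G] that is primary, hence by an
    element of [p T_p]. *)
Lemma intersection_finite (G : zmodType) (F : zmodClosed G) (p : nat) :
  prime p -> finitely_generated F -> finitely_many (@primary_multiple G p) ->
  finitely_many (fun x => in_primary_component p x /\
    exists g, exists2 f, f \in F & x = g *+ p + f).
Proof.
move=> p_pr [e [eF eE]] fin; have p_gt0 := prime_gt0 p_pr.
pose n := size e.
apply: (@finitely_many_fibers _ {ffun 'I_n -> 'I_p} _ _
  (fun x r => exists g, x = g *+ p + \sum_(i < n) e`_i *+ r i)
  (enum {ffun 'I_n -> 'I_p}) fin).
  move=> x [_ [g [f fF ->]]]; have [a ->] := eE f fF.
  have /choice[r rE] i : exists r : 'I_p, exists q : int, a i = q * p + r.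
    have lt : (absz (a i %% p)%Z < p)%N.
      by rewrite -ltz_nat gez0_abs ?modz_ge0 ?ltz_pmod // -lt0n.
    exists (Ordinal lt), (a i %/ p)%Z.
    by rewrite /= gez0_abs ?modz_ge0 -?lt0n // -divz_eq.
  have /choice[q qE] := rE.
  exists [ffun i : 'I_n => r i]; first by rewrite mem_enum.
  exists (g + \sum_(i < n) e`_i *~ q i).
  rewrite mulrnDl -addrA; congr (_ + _); rewrite -sumrMnl -big_split /=.
  apply: eq_bigr => i _; rewrite ffunE qE mulrzDr -pmulrn; congr (_ + _).
  by rewrite mulrzA -pmulrn.
move=> x y r [xp _] [yp _] [g gE] [h hE]; have [_ PB] := @is_subgroup_primary G p.
have xyE : x - y = (g - h) *+ p by rewrite gE hE mulrnBl opprD addrACA subrr addr0.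
exists (g - h) => //; have [l] := PB x y xp yp.
by rewrite xyE -mulrnA -expnS => gh; exists l.+1.
Qed.

(** The injection [phi] shows that the image of [W] in [G / N] has at least as
    many elements as [W], so the quotient map is injective on [W]. *)
Lemma finite_set_meets_trivially (G : zmodType) (N : zmodClosed G)
    (phi : {additive G -> Quotient.quot N}) (W : G -> Prop) :
  injective phi -> finitely_many W -> W 0 ->
  (forall x, W x -> exists2 y, W y & phi x = quotient_map N y) ->
  forall x, W x -> x \in N -> x = 0.
Proof.
move=> phi_inj [s sE] W0 WW x Wx xN.
pose t := undup [seq y <- s | `[< W y >]].
have tE y : (y \in t) <-> W y.
  rewrite mem_undup mem_filter.
  by split=> [/andP[/asboolP]//|Wy]; rewrite sE // andbT; apply/asboolP.
have pi_uniq : uniq [seq quotient_map N y | y <- t].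
  apply: (@leq_size_uniq _ [seq phi y | y <- t]).
  - by rewrite map_inj_uniq // undup_uniq.
  - move=> _ /mapP[y /tE/WW[z /tE zt ->] ->]; exact: map_f.
  - by rewrite !size_map.
have [xt t0] : x \in t /\ 0 \in t by split; apply/tE.
have pix : quotient_map N x = quotient_map N 0.
  by rewrite raddf0; apply/quotient_map_eq0.
pose s' := [seq quotient_map N y | y <- t].
have ix : (index x t < size s')%N by rewrite size_map index_mem.
have i0 : (index 0%R t < size s')%N by rewrite size_map index_mem.
have := nth_uniq (quotient_map N 0) ix i0 pi_uniq.
rewrite !(nth_map 0) ?index_mem // !nth_index // pix eqxx => /esym/eqP ixE.
by rewrite -[LHS](nth_index 0 xt) ixE nth_index.
Qed.

(** * Embeddings into quotients by torsion subgroups *)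

Lemma quasi_essential_multiple (G : zmodType) (F : zmodClosed G) :
  quasi_essential F -> forall x, exists2 n, (0 < n)%N & x *+ n \in F.
Proof.
move=> qe x; have [n n_gt0 xn] := qe (quotient_map F x).
by exists n => //; apply/quotient_map_eq0; rewrite raddfMn.
Qed.

(** Let [x] in [N] have infinite order.  Put [xs 0 = x] and let [xs i.+1] lift
    [phi (xs i)].  A linear relation between the [xs i], read modulo [N], is the
    image under [phi] of the shifted relation; by induction on the degree the
    shifted relation is trivial, and then so is the relation. *)
Lemma torsion_of_embedding (G : zmodType) (N : zmodClosed G)
    (phi : {additive G -> Quotient.quot N}) :
  no_infinite_free G -> injective phi ->
  forall x, x \in N -> exists2 n, (0 < n)%N & x *+ n = 0.
Proof.
move=> nofree phi_inj x xN; apply: contrapT => nontors.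
have /choice[L LE] y : exists z, phi y = quotient_map N z.
  by have [z <-] := quotient_map_surj (phi y); exists z.
pose xs i := iter i L x.
have [u uE] := poly_lift xs.
have [a /eqP a0 ua] := nofree u; apply: a0; move: ua.
elim/poly_ind: a => [//|b c IH].
have shift : quotient_map N (u (b * 'X)) = phi (u b).
  rewrite (uE b _ (leqnn _)) (uE (b * 'X) (size b).+1); last first.
    by rewrite (leq_trans (size_polyMleq _ _)) // size_polyX addn2.
  rewrite big_ord_recl coefMX eqxx mulr0z add0r !raddf_sum /=.
  by apply: eq_bigr => i _; rewrite coefMX /= !raddfMz /= LE.
have uc : u c%:P = x *~ c.
  by rewrite (uE _ 1%N) ?size_polyC_leq1 // big_ord1 coefC eqxx.
rewrite raddfD uc => ua.
have xcN : x *~ c \in N by rewrite rpredMz.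
have ub : u b = 0.
  apply: phi_inj; rewrite raddf0 -shift; apply/quotient_map_eq0.
  by rewrite -[u _](addrK (x *~ c)) ua sub0r rpredN.
rewrite (IH ub) mul0r raddf0 add0r in ua *.
have [->|c0] := eqVneq c 0; first by rewrite polyC0 add0r.
case: nontors; exists (absz c); first by rewrite absz_gt0.
move: ua; case: (c) => n // /eqP.
by rewrite NegzE mulrNz oppr_eq0 => /eqP.
Qed.

(** The number [c] acts almost as the projection to the [p]-primary part: it maps
    elements of order dividing [m] to [p]-primary ones, and it is the identity
    modulo [p ^ e.+1]. *)
Lemma split_exponent (p m e : nat) : prime p -> (0 < m)%N ->
  exists c s q, (m %| p ^ s * c)%N /\ (c = q * p ^ e.+1 + 1)%N.
Proof.
move=> p_pr m_gt0; have [m' cop mE] := pfactor_coprime p_pr m_gt0.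
have cop' : coprime (p ^ e.+1) m' by rewrite coprime_pexpl.
pose c := chinese (p ^ e.+1) m' 1 0.
exists c, (logn p m), (c %/ p ^ e.+1)%N; split.
  rewrite {1}mE mulnC dvdn_pmul2l ?expn_gt0 ?prime_gt0 //.
  by rewrite /dvdn chinese_modr // mod0n.
rewrite {1}(divn_eq c (p ^ e.+1)) chinese_modl // modn_small //.
by rewrite -{1}(expn0 p) ltn_exp2l // prime_gt1.
Qed.

(** The torsion of [G / N] is the image of the torsion of [G] when [N] is torsion;
    a lift of a primary element becomes primary when multiplied by the number [c]
    of [split_exponent], and this does not change its class. *)
Lemma primary_lift (G : zmodType) (N : zmodClosed G) (p e : nat) (a : G) :
  prime p -> (forall x, x \in N -> exists2 n, (0 < n)%N & x *+ n = 0) ->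
  a *+ (p ^ e) \in N ->
  exists2 b, in_primary_component p b & quotient_map N a = quotient_map N b.
Proof.
move=> p_pr torN aN; have [m m_gt0 am] := torN _ aN.
have [c [s [q [/dvdnP[d dE] cE]]]] := split_exponent e p_pr m_gt0.
exists (a *+ c).
  exists (e + s)%N; rewrite -mulrnA.
  (* [p ^ s * c] is a multiple of the order of [a *+ (p ^ e)]. *)
  have -> : (c * p ^ (e + s) = p ^ e * m * d)%N.
    by rewrite expnD mulnCA [(c * _)%N]mulnC dE [(d * m)%N]mulnC mulnA.
  by rewrite !mulrnA am mul0rn.
apply/quotient_map_eq; rewrite cE mulrnDr mulr1n opprD addrCA subrr addr0.
by rewrite rpredN expnSr mulnCA mulrnA rpredMn.
Qed.

Lemma primary_component_lift (G : zmodType) (N : zmodClosed G) (p : nat)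
    (phi : {additive G -> Quotient.quot N}) (x : G) :
  prime p -> (forall y, y \in N -> exists2 n, (0 < n)%N & y *+ n = 0) ->
  in_primary_component p x ->
  exists2 b, in_primary_component p b & phi x = quotient_map N b.
Proof.
move=> p_pr torN [e xe]; have [a aE] := quotient_map_surj (phi x).
rewrite -aE; apply: (@primary_lift _ N p e) => //.
by apply/quotient_map_eq0; rewrite raddfMn /= aE -raddfMn xe raddf0.
Qed.

Lemma torsion_primary_part (G : zmodType) (p m : nat) (x : G) :
  prime p -> (0 < m)%N -> x *+ m = 0 ->
  exists c, in_primary_component p (x *+ c) /\ exists g, x - x *+ c = g *+ p.
Proof.
move=> p_pr m_gt0 xm.
have [c [s [q [/dvdnP[d dE] cE]]]] := split_exponent 0 p_pr m_gt0.
exists c; split.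
  by exists s; rewrite -mulrnA mulnC dE mulnC mulrnA xm mul0rn.
exists (- (x *+ q)); rewrite cE expn1 mulrnDr mulr1n opprD addrCA subrr addr0.
by rewrite mulrnA mulNrn.
Qed.

(** Each generator of [F] needs a multiple; [k] is their product. *)
Lemma embedding_denominator (G H : zmodType) (F : zmodClosed G)
    (phi pi : {additive G -> H}) :
  finitely_generated F -> (forall q, exists x, pi x = q) ->
  (forall x : G, exists2 n, (0 < n)%N & x *+ n \in F) ->
  exists2 k, (0 < k)%N &
    forall f, f \in F -> exists2 f', f' \in F & phi f *+ k = pi f'.
Proof.
move=> [e [eF eE]] pi_surj qe.
have [|I IE] := @subgroup_of_prop H (fun q => exists2 f, f \in F & q = pi f).
  split; first by exists 0; rewrite ?rpred0 ?raddf0.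
  by move=> _ _ [f fF ->] [g gF ->]; exists (f - g); rewrite ?rpredB ?raddfB.
have /choice[m mE] i : exists m, (0 < m)%N /\ phi e`_i *+ m \in I.
  have [g gE] := pi_surj (phi e`_i); have [m m_gt0 gm] := qe g.
  exists m; split=> //; apply/IE; exists (g *+ m) => //.
  by rewrite raddfMn gE.
exists (\prod_(i < size e) m i)%N; first by apply: prodn_gt0 => i; case: (mE i).
move=> f /eE[a ->]; apply/IE; rewrite raddf_sum -sumrMnl; apply: rpred_sum => i _.
rewrite raddfMz (bigD1 i) //= mulrnA; apply: rpredMn.
by rewrite pmulrn -mulrzA mulrC mulrzA -pmulrn rpredMz //; case: (mE i).
Qed.

(** The splitting criterion is applied with [k] such that [phi] maps [k F] into the
    image of [F].  For [p] prime to [k], modulo [p] the map [phi] sends [F] into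
    the image of [F], hence the finite group [W_p] into its own image. *)
Lemma generalized_Bassian_of_finite_invariants (G : zmodType) (F : zmodClosed G) :
  free_subgroup F -> quasi_essential F -> finite_invariants G ->
  generalized_Bassian G.
Proof.
move=> F_free /quasi_essential_multiple qe [nofree fin] N [phi phi_inj].
pose pi := quotient_map N.
have torN := torsion_of_embedding nofree phi_inj.
have fgF := free_subgroup_finitely_generated F_free nofree.
have [k k_gt0 kE] := embedding_denominator phi fgF (@quotient_map_surj _ N) qe.
apply: (direct_summand_of_primewise k_gt0 qe torN).
  move=> p x p_pr xN xp [g xE].
  apply: (finite_set_meets_trivially phi_inj (fin p p_pr)) xN.
  - by exists 0; [exists 0%N; rewrite mul0rn|rewrite mul0rn].
  - move=> _ [t tp ->]; have [b bp bE] := primary_component_lift phi p_pr torN tp.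
    by exists (b *+ p); [exists b|rewrite !raddfMn /= bE].
  - by exists g => //; exists 2%N; rewrite expnS expn1 mulrnA -xE.
move=> p x p_pr pNk xN xp xE.
apply: (finite_set_meets_trivially phi_inj (intersection_finite p_pr fgF (fin p p_pr))) xN.
- split; first by exists 0%N; rewrite mul0rn.
  by exists 0, 0; rewrite ?rpred0 // mul0rn addr0.
- move=> y [yp [g [f fF yE]]]; have [b bp bE] := primary_component_lift phi p_pr torN yp.
  have [f1 f1F f1E] := kE f fF.
  have [[g1 g1E] [l lE]] := (quotient_map_surj (phi g), quotient_map_surj (phi f)).
  (* Since [k] is invertible modulo [p], [phi f] is a multiple of [phi f *+ k] up to
     a multiple of [p]. *)
  have [c [q cE]] : exists c q, (k * c = q * p + 1)%N.
    have [c [s [q [/dvdnP[d dE] cE]]]] := split_exponent 0 p_pr k_gt0.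
    have : coprime k (p ^ s) by rewrite coprime_sym coprimeXl // prime_coprime.
    move=> cop; have /dvdnP[c' c'E] : (k %| c)%N.
      by rewrite -(Gauss_dvdr _ cop) dE dvdn_mull.
    by exists c', q; rewrite mulnC -c'E cE expn1.
  pose g2 := g1 - l *+ q; pose f2 := f1 *+ c.
  have piE : pi (g2 *+ p + f2) = phi y.
    rewrite yE !raddfD !raddfMn raddfB raddfMn /= g1E lE -f1E -mulrnA cE.
    by rewrite mulrnDr mulr1n mulrnBl mulrnA -addrA addKr.
  pose z := b - (g2 *+ p + f2).
  have zN : z \in N by apply/quotient_map_eq; rewrite piE -bE.
  have [m m_gt0 zm] := torN z zN.
  (* Only the primary part of [z] may be subtracted, as [b] has to stay primary; the
     rest of [z] is a multiple of [p]. *)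
  have [d [zd [h hE]]] := torsion_primary_part p_pr m_gt0 zm.
  exists (b - z *+ d).
    split; first by have [_] := @is_subgroup_primary G p; apply.
    exists (g2 + h), f2; first exact: rpredMn.
    have -> : b - z *+ d = (g2 *+ p + f2) + (z - z *+ d).
      by rewrite addrA [_ + z]addrC subrK.
    by rewrite hE [(g2 + h) *+ p]mulrnDl addrAC.
  by rewrite bE; apply/quotient_map_eq; rewrite opprB addrCA subrr addr0 rpredMn.
by split=> //; exists 1%N; rewrite expn1.
Qed.

(** * B+E-groups *)

Lemma Bassian_generalized_Bassian (G : zmodType) :
  Bassian G -> generalized_Bassian G.
Proof.
move=> bas N embed; have N0 := bas N embed.
have [|B BE] := @subgroup_of_prop G (fun _ => True); first by [].
exists B; split=> [x|x xN _]; last exact: N0.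
by exists 0, x; split; rewrite ?rpred0 ?add0r //; apply/BE.
Qed.

(** A free family in [A + E] becomes a free family in [A] after multiplying its
    members by integers that kill their [E]-components; and multiplication by
    [p] kills the [E]-components of primary elements. *)
Lemma BE_group_finite_invariants (G : zmodType) :
  BE_group G -> finite_invariants G.
Proof.
case=> A [E [[sumAE disAE] /Bassian_generalized_Bassian GB_A [torE elE]]].
split=> [u|p p_pr].
  have nofree := generalized_Bassian_no_infinite_free GB_A.
  have /choice[m mE] i : exists m, (0 < m)%N /\ u 'X^i *+ m \in A.
    have [a [e [aA eE ->]]] := sumAE (u 'X^i).
    have [m m_gt0 /(congr1 val)] := torE (SubgroupElt eE).
    rewrite raddfMn raddf0 /= => em.
    by exists m; rewrite mulrnDl em addr0 rpredMn.
  pose y i : subgroup_type A := SubgroupElt (proj2 (mE i)).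
  have [v vE] := poly_lift y; have [a a0 va] := nofree v.
  exists (\poly_(i < size a) (a`_i * m i)).
    apply/eqP => /polyP/(_ (size a).-1); rewrite coef0 coef_poly prednK ?size_poly_gt0 //.
    rewrite leqnn => /eqP; rewrite mulf_eq0 -lead_coefE lead_coef_eq0 (negPf a0) /=.
    by have [] := mE (size a).-1; rewrite lt0n => /negPf h _; rewrite eqz_nat h.
  have := congr1 val va; rewrite (vE a _ (leqnn _)) raddf0 raddf_sum => <-.
  rewrite poly_def raddf_sum; apply: eq_bigr => i _.
  by rewrite -[a`_i * _]intz scaler_int !raddfMz /= mulrC mulrzA.
have [s sE] := generalized_Bassian_finite_primary_multiple p_pr GB_A.
exists [seq val x | x <- s] => _ [t [k tk] ->].
have [a [e [aA eE tE]]] := sumAE t.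
have ak : a *+ (p ^ k) = - (e *+ (p ^ k)).
  by apply/eqP; rewrite -addr_eq0 -mulrnDl -tE tk.
have ak0 : a *+ (p ^ k) = 0.
  by apply: disAE; [exact: rpredMn|rewrite ak rpredN rpredMn].
have e0 : e *+ p = 0.
  have ep : in_primary_component p (SubgroupElt eE).
    exists k; apply: val_inj; rewrite raddfMn raddf0 /=.
    by rewrite -[LHS]opprK -ak ak0 oppr0.
  by have /(congr1 val) := elE p p_pr _ ep; rewrite raddfMn raddf0.
apply/mapP; exists (SubgroupElt aA *+ p); last first.
  by rewrite raddfMn /= tE mulrnDl e0 addr0.
apply: sE; exists (SubgroupElt aA) => //; exists k; apply: val_inj.
by rewrite raddfMn raddf0.
Qed.

(** A nontrivial [N] would be torsion, so it would contain an element of prime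
    order [p]; this is excluded by counting in the finite group [T_p]. *)
Lemma Bassian_of_finite_primary (G : zmodType) :
  no_infinite_free G ->
  (forall p, prime p -> finitely_many (@in_primary_component G p)) -> Bassian G.
Proof.
move=> nofree fin N [phi phi_inj] x xN; apply: contrapT => x0.
have torN := torsion_of_embedding nofree phi_inj.
have [n n_gt0 xn] := torN x xN.
have [p [j [p_pr xj xjp]]] := torsion_prime_multiple n_gt0 xn x0.
apply: xj; apply: (finite_set_meets_trivially phi_inj (fin p p_pr)).
- by exists 0%N; rewrite mul0rn.
- by move=> t; apply: primary_component_lift.
- by exists 1%N; rewrite expn1.
- exact: rpredMn.
Qed.

(** [N] is maximal among torsion subgroups whose [p]-socles avoid [p G + F].  It
    splits off by [direct_summand_of_primewise] with [k = 1].  If [x] in the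
    complement [A] has order [p], adding [x] to [N] spoils the condition, which
    puts [x] in [N + W_p]; since [A] avoids [N], the [p]-socle of [A] injects
    into the finite group [W_p]. *)
Lemma BE_group_of_finite_invariants (G : zmodType) (F : zmodClosed G) :
  free_subgroup F -> quasi_essential F -> finite_invariants G -> BE_group G.
Proof.
move=> F_free /quasi_essential_multiple qe [nofree fin].
have fgF := free_subgroup_finitely_generated F_free nofree.
pose inF p (x : G) := exists g, exists2 f, f \in F & x = g *+ p + f.
pose phi x := (exists2 n, (0 < n)%N & x *+ n = 0) /\
  forall p, prime p -> x *+ p = 0 -> inF p x -> x = 0.
have [|Z ZE] := @subgroup_of_prop G (fun x => x = 0).
  by split=> // _ _ -> ->; rewrite subrr.
have [_ /ZE ->|N [_ phiN maxN]] := @subset_maximal_subgroup G phi Z.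
  by split=> //; exists 1%N; rewrite ?mulr1n.
have torN x : x \in N -> exists2 n, (0 < n)%N & x *+ n = 0 by move=> /phiN[].
have pureN p x : prime p -> x \in N -> x *+ p = 0 ->
    (exists g, x = g *+ p) -> x = 0.
  move=> p_pr /phiN[_ h] xp [g xE]; apply: (h p) => //.
  by exists g, 0; rewrite ?rpred0 ?addr0.
have [p x p_pr _ /phiN[_ h] xp|A [sumNA disNA]] :=
    @direct_summand_of_primewise G F N 1 isT qe torN pureN; first exact: h.
exists A, N; split.
- split=> x; last by move=> *; apply: disNA.
  by have [n [a [nN aA ->]]] := sumNA x; exists a, n; rewrite addrC.
- have finA p : prime p -> finitely_many (fun x => in_primary_component p x /\ x \in A).
    move=> p_pr; have p_gt0 := prime_gt0 p_pr.
    have socleA x : x \in A -> x *+ p = 0 ->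
        exists2 w, in_primary_component p w /\ inF p w & x - w \in N.
      move=> xA xp; apply: contrapT => none.
      have xN : x \notin N.
        apply/negP => xN; apply: none; exists 0; rewrite ?subr0 //.
        split; first by exists 0%N; rewrite mul0rn.
        by exists 0, 0; rewrite ?rpred0 // mul0rn addr0.
      have xjp (j : int) : x *~ j *+ p = 0.
        by rewrite pmulrn -mulrzA mulrC mulrzA -pmulrn xp mul0rz.
      have [|N' N'E] := @subgroup_of_prop G
          (fun z => exists n, n \in N /\ exists j : int, z = n + x *~ j).
        split; first by exists 0; rewrite rpred0; split=> //; exists 0; rewrite mulr0z addr0.
        move=> _ _ [n [nN [j ->]]] [n' [n'N [j' ->]]].
        exists (n - n'); rewrite rpredB //; split=> //.
        by exists (j - j'); rewrite mulrzBr addrACA opprD.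
      case/negP: xN; apply: (maxN N') => [z zN|z|].
      + by apply/N'E; exists z; split=> //; exists 0; rewrite mulr0z addr0.
      + case/N'E=> n [nN [j zE]]; split.
          have [m m_gt0 nm] := torN n nN; exists (m * p)%N.
            by rewrite muln_gt0 m_gt0.
          by rewrite zE mulrnDl mulrnA nm mul0rn add0r mulnC mulrnA xjp mul0rn.
        move=> q q_pr zq zF.
        suff xj : x *~ j = 0.
          rewrite xj addr0 in zE; rewrite zE in zq zF *.
          by have [_ /(_ q)] := phiN n nN; apply.
        have nq : n *+ q = - (x *~ j *+ q).
          by apply/eqP; rewrite -addr_eq0 -mulrnDl -zE zq.
        have nq0 : n *+ q = 0.
          by apply: disNA; [exact: rpredMn|rewrite nq rpredN rpredMn ?rpredMz].
        have xjq : x *~ j *+ q = 0 by apply/eqP; rewrite -oppr_eq0 -nq nq0.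
        have [qp|qp] := eqVneq q p; last first.
          have [||c ->] := @primary_mulrn_inverse G p q (x *~ j) p_pr.
          * by rewrite prime_coprime // dvdn_prime2 // eq_sym.
          * by exists 1%N; rewrite expn1.
          * by rewrite -mulrnA mulnC mulrnA xjq mul0rn.
        rewrite qp in zq zF; have [/dvdzP[d ->]|pNj] := boolP (p %| j)%Z.
          by rewrite mulrC mulrzA -pmulrn xp mul0rz.
        have /coprimezP[[j' d] /= bez] : coprimez j p.
          by rewrite coprimezE coprime_sym prime_coprime.
        case: none; exists (z *~ j').
          split; first by exists 1%N; rewrite expn1 pmulrn -mulrzA mulrC mulrzA -pmulrn zq mul0rz.
          have [g [f fF zgf]] := zF; exists (g *~ j'), (f *~ j'); first exact: rpredMz.
          rewrite {1}zgf mulrzDl; congr (_ + _).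
          by rewrite !pmulrn -!mulrzA mulrC.
        have -> : x = x *~ j *~ j'.
          rewrite -mulrzA mulrC -[LHS]mulr1z -bez mulrzDr [d * _]mulrC.
          by rewrite [X in _ + X]mulrzA -pmulrn xp mul0rz addr0.
        by rewrite zE mulrzDl opprD addrCA subrr addr0 rpredN rpredMz.
      + by apply/N'E; exists 0; rewrite rpred0; split=> //; exists 1; rewrite add0r.
    have [sW sWE] := intersection_finite p_pr fgF (fin p p_pr).
    have fin_socle : finitely_many (fun x => x \in A /\ x *+ p = 0).
      apply: (@finitely_many_fibers _ _ _ (fun x => x = 0)
        (fun x w => x - w \in N) sW); first by exists [:: 0] => x ->; rewrite inE.
        by move=> x [xA xp]; have [w wW xw] := socleA x xA xp; exists w => //; apply: sWE.
      move=> x y w [xA _] [yA _] xw yw; apply: disNA; last exact: rpredB.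
      have -> : x - y = (x - w) - (y - w) by rewrite opprB subrKA.
      exact: rpredB.
    have [s sE] := fin p p_pr.
    apply: (@finitely_many_fibers _ _ _ _ (fun x y => x *+ p = y) s fin_socle).
      by move=> x [xp _]; exists (x *+ p) => //; apply: sE; exists x.
    move=> x y z [_ xA] [_ yA] <- xy; rewrite rpredB //; split=> //.
    by rewrite mulrnBl xy subrr.
  apply: Bassian_of_finite_primary => [u|p p_pr].
    have [a a0 ua] := nofree (val \o u : {additive {poly int} -> G}).
    by exists a => //; apply: val_inj; rewrite raddf0.
  have [s sE] := finA p p_pr; exists (pmap insub s) => x [k xk].
  rewrite mem_pmap_sub; apply: sE; split; last exact: valP.
  by exists k; rewrite -raddfMn xk raddf0.
- split=> [x|p p_pr x [k /(congr1 val)]].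
    have [n n_gt0 xn] := torN (val x) (valP x); exists n => //.
    by apply: val_inj; rewrite raddfMn raddf0.
  rewrite raddfMn raddf0 => xk; apply: val_inj; rewrite raddfMn raddf0.
  elim: k xk => [|[|k] IH] xk; first by move: xk; rewrite mulr1n => ->; rewrite mul0rn.
    by rewrite expn1 in xk.
  apply: IH; apply: (pureN p) => //; first by apply: rpredMn; exact: valP.
    by rewrite -mulrnA -expnSr.
  by exists (val x *+ (p ^ k)); rewrite -mulrnA -expnSr.
Qed.

Theorem theorem4p7 (G : zmodType) (F : zmodClosed G)
  (F_free : free_subgroup F)
  (F_nice : nice F)
  (F_quasi_essential : quasi_essential F) :
  generalized_Bassian G <-> BE_group G.
Proof.
split=> [GB|/BE_group_finite_invariants]; last first.
  exact: generalized_Bassian_of_finite_invariants F_quasi_essential.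
apply: BE_group_of_finite_invariants F_free F_quasi_essential _.
split; first exact: generalized_Bassian_no_infinite_free.
by move=> p p_pr; apply: generalized_Bassian_finite_primary_multiple.
Qed.
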